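(* The following hold for symmetric functions. (1) If $\sum_\lambda m_\lambda S_\lambda$ is doubly symmetric, then for each $n$ so is the sum $\sum_{\lambda\vdash n} m_\lambda S_\lambda$ over partitions of $n$. (2) If $\sum_\lambda m_\lambda S_\lambda$ is doubly symmetric, then $m_\lambda=m_{\lambda'}$ for each partition $\lambda$, where $\lambda'$ is the conjugate of $\lambda$. (3) The product of doubly symmetric functions is doubly symmetric.
   Context: Symmetric functions are taken over $\mathbb{Q}$, with basis the Schur functions $S_\lambda$ indexed by all partitions (including the empty one). Hook Schur functions: for finite, possibly empty, lists of variables $X=(x_1,\ldots,x_k)$, $Y=(y_1,\ldots,y_\ell)$, a $(k,\ell)$-semistandard tableau of shape $\lambda$ is a filling of the Young diagram of $\lambda$ with entries from the ordered alphabet $1<2<\cdots<k<1'<\cdots<\ell'$ such that entries are non-decreasing in each row and each column, unprimed symbols may repeat in rows but not in columns, and primed symbols may repeat in columns but not in rows. Then $HS_\lambda(X;Y)=\sum_T x^T$, summed over all such tableaux $T$, where $x^T=\prod_j x_j^{\#\{j \text{ in } T\}}\prod_j y_j^{\#\{j'\text{ in }T\}}$. A symmetric function $\sum_\lambda m_\lambda S_\lambda$ is doubly symmetric if for all finite (possibly empty) sets of variables $X,Y$ one has $\sum_\lambda m_\lambda S_\lambda(X,Y)=\sum_\lambda m_\lambda HS_\lambda(X;Y)$, where $S_\lambda(X,Y)$ is the Schur polynomial in all the variables of $X$ and $Y$ together. *)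

(* Defs.v *)
From HB Require Import structures.
From mathcomp Require Import all_boot all_order all_algebra.
From mathcomp Require Import finmap mpoly.

Set Implicit Arguments.
Unset Strict Implicit.
Unset Printing Implicit Defensive.

Import GRing.Theory.
Local Open Scope ring_scope.

Definition is_part (s : seq nat) : bool := sorted geq s && (0%N \notin s).

Record intpart := IntPart { parts :> seq nat; _ : is_part parts }.

HB.instance Definition _ := [isSub for parts].
HB.instance Definition _ := [Countable of intpart by <:].

Definition conj_seq (s : seq nat) : seq nat :=
  mkseq (fun j => count (fun p => j < p)%N s) (head 0%N s).

Lemma is_part_conj (la : intpart) : is_part (conj_seq la).
Proof.
apply/andP; split.
  rewrite /conj_seq /mkseq sorted_map.
  apply: (@sub_sorted _ ltn); last exact: iota_ltn_sorted.
  by move=> i j lt_ij /=; apply: sub_count => p; apply: ltn_trans.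
apply/negP => /mapP[j]; rewrite mem_iota add0n /= => lt_j /eqP.
case: la lt_j => -[|p s] _ //= lt_j.
by rewrite lt_j.
Qed.

Definition conj_part (la : intpart) : intpart := IntPart (is_part_conj la).

(* Cells of the Young diagram, in English notation: row i has la_i cells. *)
Definition cell (la : intpart) : finType :=
  {i : 'I_(size la) & 'I_(nth 0%N la i)}.

Definition cell_row (la : intpart) (c : cell la) : nat := tag c.
Definition cell_col (la : intpart) (c : cell la) : nat := tagged c.

Definition filling (n : nat) (la : intpart) : finType :=
  {ffun cell la -> 'I_n}.

Definition weight (n : nat) (la : intpart) (T : filling n la)
  : {mpoly rat[n]} := \prod_(c : cell la) 'X_(T c).

Definition is_ssyt (n : nat) (la : intpart) (T : filling n la) : bool :=
  [forall c : cell la, forall d : cell la,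
     ((cell_row c == cell_row d) && (cell_col c < cell_col d)%N
        ==> (T c <= T d)%N)
  && ((cell_col c == cell_col d) && (cell_row c < cell_row d)%N
        ==> (T c < T d)%N)].

Definition schur (n : nat) (la : intpart) : {mpoly rat[n]} :=
  \sum_(T : filling n la | is_ssyt T) weight T.

(* The alphabet 1 < ... < k < 1' < ... < l' is 'I_(k + l) with its usual      *)
(* order: the values below k are the unprimed symbols and index the variables *)
(* X, the others are the primed symbols and index the variables Y.            *)
Definition primed (k l : nat) (a : 'I_(k + l)) : bool := (k <= a)%N.

Definition is_hook_ssyt (k l : nat) (la : intpart) (T : filling (k + l) la)
  : bool :=
  [forall c : cell la, forall d : cell la,
     ((cell_row c == cell_row d) && (cell_col c < cell_col d)%N
        ==> (T c <= T d)%N && (primed (T c) ==> (T c != T d)))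
  && ((cell_col c == cell_col d) && (cell_row c < cell_row d)%N
        ==> (T c <= T d)%N && (~~ primed (T c) ==> (T c != T d)))].

Definition hook_schur (k l : nat) (la : intpart) : {mpoly rat[k + l]} :=
  \sum_(T : filling (k + l) la | is_hook_ssyt T) weight T.

(* A symmetric function over Q, given by its coordinates in the basis of      *)
(* Schur functions: m stands for the finite sum of the (m la) S_la.           *)
Definition symfun : Type := {fsfun intpart -> rat with 0}.

Definition schur_sum (m : symfun) (n : nat) : {mpoly rat[n]} :=
  \sum_(la <- finsupp m) m la *: schur n la.

Definition hook_schur_sum (m : symfun) (k l : nat) : {mpoly rat[k + l]} :=
  \sum_(la <- finsupp m) m la *: hook_schur k l la.

Definition doubly_symmetric (m : symfun) : Prop :=
  forall k l : nat, schur_sum m (k + l) = hook_schur_sum m k l.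

Definition degree_part (n : nat) (m : symfun) : symfun :=
  [fsfun la in finsupp m => if sumn la == n then m la else 0].

(* p is the product of f and g in the ring of symmetric functions; that ring  *)
(* embeds in the product over n of the polynomial rings in n variables, so    *)
(* this determines p.                                                         *)
Definition is_product (f g p : symfun) : Prop :=
  forall n : nat, schur_sum p n = schur_sum f n * schur_sum g n.

(* Main.v *)
Require Import Defs.
From mathcomp Require Import all_boot all_order all_algebra.
From mathcomp Require Import finmap mpoly zify ring.

Set Implicit Arguments.
Unset Strict Implicit.
Unset Printing Implicit Defensive.

Import GRing.Theory.
Local Open Scope nat_scope.

(* Adding one last letter x to the alphabet turns the function la |-> S_la    *)
(* into its transform by an operator, [hop x] if x is unprimed (the new       *)
(* letters fill a horizontal strip) or [vop x] if x is primed (a vertical     *)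
(* strip). Let [uop r] be multiplication by h_r, i.e. la |-> the sum of the   *)
(* S_mu with mu/la a horizontal strip of size r. A local bijection on         *)
(* partitions gives a commutation rule between [uop r] and [hop x], and       *)
(* [hop x] is inverse to [vop (- x)], which yields the rule for [vop]. Hence  *)
(* the same Pieri rule holds for all words of primed and unprimed letters,    *)
(* and S_la is, by one triangular recursion on the first row, a polynomial in *)
(* the h_r independent of the word. So the linear maps S_la |-> HS_la(X;Y)    *)
(* are multiplicative for one product on symmetric functions, which gives     *)
(* (3). Taking X empty gives HS_la(;Y) = S_la'(Y), and the same triangularity *)
(* shows that Schur polynomials are independent, which gives (2). Finally (1) *)
(* holds because S_la and HS_la are homogeneous of degree |la|.               *)

Implicit Types la mu nu rho : intpart.

(** Double symmetry says that two linear evaluations, S_la to S_la(X,Y) and S_la to HS_la(X;Y),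
    agree on a symmetric function. Both have the form [word_fun w]: removing the cells that hold the
    largest letter leaves a tableau of smaller shape, and those cells form a horizontal or a
    vertical strip ([tableau_sumS], [hook_filling_sum]).

    For (3), both evaluations must be multiplicative for one and the same product. By [pieri_word],
    in every word the sum of the values over all ways to add a horizontal strip of size r is a
    scalar multiple of the value, and this scalar is the value of h_r; the proof rests on the
    bijection [local_rule] and the inversion [hop_vop]. Since S_la is h_{la_0} times S of la without
    its first row, minus terms with a longer first row, [comb_mul] expands a product in a way that
    is valid in all words at once.

    For (2), an empty X turns HS_la into the Schur polynomial of the conjugate ([word_fun_conj]),
    and Schur polynomials are linearly independent ([word_fun_free]). For (1), degree parts give the
    homogeneous components on both sides ([degree_part_sum]). *)

(** * Partitions as decreasing functions of the row index *)

Definition rowlen (la : intpart) (i : nat) : nat := nth 0 la i.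

Lemma rowlen_default (la : intpart) i : size la <= i -> rowlen la i = 0.
Proof. exact: nth_default. Qed.

Lemma rowlen_gt0 (la : intpart) i : (0 < rowlen la i) = (i < size la).
Proof.
case: (ltnP i (size la)) => [lt_i|le_i]; last by rewrite rowlen_default.
case: la lt_i => s /= s_part lt_i; have /andP[_ s0] := s_part.
by rewrite lt0n; apply: contraNneq s0 => <-; apply: mem_nth.
Qed.

Lemma rowlen_anti (la : intpart) i j : i <= j -> rowlen la j <= rowlen la i.
Proof.
move=> le_ij; case: (ltnP j (size la)) => [lt_j|le_j]; last by rewrite rowlen_default.
case: la lt_j => s /= s_part lt_j; have /andP[s_sorted _] := s_part.
apply: (sorted_leq_nth (leT := geq)) => //.
- by move=> a b c /= ba cb; apply: leq_trans ba.
- exact: leqnn.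
- exact: leq_ltn_trans lt_j.
Qed.

Lemma rowlen_inj (la mu : intpart) : rowlen la =1 rowlen mu -> la = mu.
Proof.
have le_size a b : rowlen a =1 rowlen b -> size a <= size b.
  by move=> ab; rewrite leqNgt -(rowlen_gt0 a) ab rowlen_gt0 ltnn.
move=> eq_r; apply/val_inj/(@eq_from_nth _ 0) => [|i _]; last exact: eq_r.
by apply/eqP; rewrite eqn_leq !le_size.
Qed.

Lemma sumn_rowlen (la : intpart) M :
  size la <= M -> sumn la = \sum_(i < M) rowlen la i.
Proof.
move=> le_M; rewrite sumnE (big_nth 0) big_mkord.
rewrite (big_ord_widen _ (fun i => rowlen la i) le_M) big_mkcond /=.
by apply: eq_bigr => i _; case: ltnP => // /rowlen_default.
Qed.

Lemma size_le_sumn (la : intpart) : size la <= sumn la.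
Proof.
rewrite (sumn_rowlen (leqnn _)) -{1}[size la]card_ord -sum1_card.
by apply: leq_sum => i _; rewrite rowlen_gt0.
Qed.

Lemma rowlen_le_sumn (la : intpart) i : rowlen la i <= sumn la.
Proof.
apply: (leq_trans (rowlen_anti la (leq0n i))).
rewrite (sumn_rowlen (leqnSn _)) big_ord_recl; exact: leq_addr.
Qed.

Lemma sumn_le (mu la : intpart) :
  (forall i, rowlen mu i <= rowlen la i) -> sumn mu <= sumn la.
Proof.
move=> le_r; rewrite (sumn_rowlen (leq_addr (size la) (size mu))).
rewrite (sumn_rowlen (leq_addl (size mu) (size la))).
exact: leq_sum.
Qed.

Lemma sumn_le_eq (mu la : intpart) :
  (forall i, rowlen mu i <= rowlen la i) -> sumn la <= sumn mu -> mu = la.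
Proof.
move=> le_r le_s; apply: rowlen_inj => i.
have [K [le_mu le_la lt_i]] :
    exists K, [/\ size mu <= K, size la <= K & i < K].
  by exists (size mu + size la + i.+1); split; lia.
move: le_s; rewrite (sumn_rowlen le_mu) (sumn_rowlen le_la).
have /leqifP := leqif_sum (fun (j : 'I_K) (_ : true) => leqif_eq (le_r j)).
case: forallP => [eq_r _ _|_ ]; last by rewrite ltnNge => /negPf->.
exact/eqP/(eq_r (Ordinal lt_i)).
Qed.

Fact is_part_nil : is_part [::]. Proof. by []. Qed.
Definition empty_part := IntPart is_part_nil.

Lemma sumn_eq0 (la : intpart) : (sumn la == 0) = (la == empty_part).
Proof.
apply/eqP/eqP => [la0|-> //]; apply: val_inj => /=; apply: size0nil.
by have := size_le_sumn la; lia.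
Qed.

(** The partition is cut at the first zero of f below M. The fallback to the empty partition never
    occurs under the hypotheses of [rowlen_mkpart]. *)
Definition mkpart (M : nat) (f : nat -> nat) : intpart :=
  insubd empty_part (mkseq f (find (fun i => f i == 0) (iota 0 M))).

Lemma rowlen_mkpart M f :
    {homo f : i j / i <= j >-> j <= i} -> f M = 0 ->
  rowlen (mkpart M f) =1 f.
Proof.
move=> f_anti fM0; set p := find (fun i => f i == 0) (iota 0 M).
have p_le : p <= M by rewrite -[leqRHS](size_iota 0 M) find_size.
have f_gt0 i : i < p -> 0 < f i.
  move=> lt_ip; rewrite lt0n; have := before_find 0 lt_ip.
  by rewrite nth_iota ?add0n; [move->|lia].
have fp0 : f p = 0.
  case: (ltnP p M) => [lt_p|ge_p]; last by rewrite (_ : p = M) //; lia.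
  have has_p : has (fun i => f i == 0) (iota 0 M) by rewrite has_find size_iota.
  by have /eqP := nth_find 0 has_p; rewrite nth_iota.
have part_p : is_part (mkseq f p).
  apply/andP; split.
    rewrite /mkseq sorted_map; apply: (@sub_sorted _ leq); last exact: iota_sorted.
    by move=> i j le_ij; apply: f_anti.
  apply/negP => /mapP[j]; rewrite mem_iota /= => lt_j.
  by have := f_gt0 j lt_j; lia.
move=> i; rewrite /rowlen /mkpart -/p val_insubd part_p.
case: (ltnP i p) => [lt_i|le_i]; first by rewrite nth_mkseq.
rewrite nth_default ?size_mkseq //.
by have := f_anti _ _ le_i; lia.
Qed.

(** * Finite lists of partitions *)

Fixpoint bounded_seqs (N k : nat) : seq (seq nat) :=
  if k is k'.+1 then
    [::] :: [seq x :: s | x <- index_iota 0 N.+1, s <- bounded_seqs N k']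
  else [:: [::]].

Lemma mem_bounded_seqs N k s :
  size s <= k -> all (fun x => x <= N) s -> s \in bounded_seqs N k.
Proof.
elim: k s => [|k IHk] [|x s] // le_s /andP[le_x all_s].
rewrite in_cons; apply/orP; right.
apply/allpairsP; exists (x, s); split=> //; last exact: IHk.
by rewrite mem_index_iota.
Qed.

(** A partition of size at most N has at most N rows, each of length at most N, so none is missed;
    these lists index all sums over partitions. *)
Definition parts_upto (N : nat) : seq intpart :=
  [seq la : intpart <- undup (pmap insub (bounded_seqs N N)) | sumn la <= N].

Lemma mem_parts_upto N la : (la \in parts_upto N) = (sumn la <= N).
Proof.
rewrite mem_filter andb_idr // => le_N.
rewrite mem_undup mem_pmap_sub; apply: mem_bounded_seqs.
  exact: leq_trans (size_le_sumn la) le_N.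
apply/(all_nthP 0) => i _; exact: leq_trans (rowlen_le_sumn la i) le_N.
Qed.

Lemma uniq_parts_upto N : uniq (parts_upto N).
Proof. by rewrite filter_uniq // undup_uniq. Qed.

Lemma mem_filter_parts_upto N (P : pred intpart) la :
  (la \in [seq mu <- parts_upto N | P mu]) = P la && (sumn la <= N).
Proof. by rewrite mem_filter mem_parts_upto. Qed.

Lemma uniq_filter_parts_upto N (P : pred intpart) :
  uniq [seq la <- parts_upto N | P la].
Proof. exact: filter_uniq (uniq_parts_upto N). Qed.

(** * Horizontal and vertical strips *)

(** Interlacing of the rows means that la/mu has at most one cell in each column. Testing finitely
    many rows is enough, as both partitions vanish beyond them; the same holds for [vstrip], with at
    most one cell in each row. *)
Definition hstrip (mu la : intpart) : bool :=
  all (fun i => rowlen la i.+1 <= rowlen mu i <= rowlen la i)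
      (iota 0 (size mu + size la)).

Definition vstrip (mu la : intpart) : bool :=
  all (fun i => rowlen mu i <= rowlen la i <= (rowlen mu i).+1)
      (iota 0 (size mu + size la)).

Lemma hstripP mu la :
  reflect (forall i, rowlen la i.+1 <= rowlen mu i <= rowlen la i)
          (hstrip mu la).
Proof.
apply: (iffP allP) => [h i|h i _]; last exact: h.
case: (ltnP i (size mu + size la)) => lt_i; first by apply: h; rewrite mem_iota.
by rewrite !rowlen_default //; lia.
Qed.

Lemma vstripP mu la :
  reflect (forall i, rowlen mu i <= rowlen la i <= (rowlen mu i).+1)
          (vstrip mu la).
Proof.
apply: (iffP allP) => [h i|h i _]; last exact: h.
case: (ltnP i (size mu + size la)) => lt_i; first by apply: h; rewrite mem_iota.
by rewrite !rowlen_default //; lia.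
Qed.

Lemma hstrip_sumn mu la : hstrip mu la -> sumn mu <= sumn la.
Proof. by move/hstripP=> h; apply: sumn_le => i; case/andP: (h i). Qed.

Lemma vstrip_sumn mu la : vstrip mu la -> sumn mu <= sumn la.
Proof. by move/vstripP=> h; apply: sumn_le => i; case/andP: (h i). Qed.

Lemma hstrip_eq mu la : hstrip mu la -> sumn la <= sumn mu -> mu = la.
Proof. by move/hstripP=> h; apply: sumn_le_eq => i; case/andP: (h i). Qed.

Lemma hstrip_refl la : hstrip la la.
Proof. by apply/hstripP => i; rewrite leqnn rowlen_anti. Qed.

(** * Sums over partitions *)

Section BigParts.
Variables (V : nmodType).
Local Open Scope ring_scope.

Lemma big_parts_widen N M (P : pred intpart) (F : intpart -> V) :
    (N <= M)%N -> (forall la, P la -> (sumn la <= N)%N) ->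
  \sum_(la <- parts_upto N | P la) F la = \sum_(la <- parts_upto M | P la) F la.
Proof.
move=> le_NM P_le; rewrite -big_filter -[RHS]big_filter; apply: perm_big.
apply: uniq_perm; rewrite ?uniq_filter_parts_upto // => la.
rewrite !mem_filter_parts_upto; case P_la: (P la) => //=.
by have := P_le _ P_la; lia.
Qed.

Lemma big_parts_reindex N M (P Q : pred intpart) (f g : intpart -> intpart)
    (F : intpart -> V) :
    (forall la : intpart, (sumn la <= N)%N -> P la ->
       [/\ (sumn (f la) <= M)%N, Q (f la) & g (f la) = la]) ->
    (forall la : intpart, (sumn la <= M)%N -> Q la ->
       [/\ (sumn (g la) <= N)%N, P (g la) & f (g la) = la]) ->
  \sum_(la <- parts_upto M | Q la) F la =
    \sum_(la <- parts_upto N | P la) F (f la).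
Proof.
move=> PQ QP; rewrite -big_filter -[RHS]big_filter -[RHS](big_map f xpredT F).
apply: perm_big; apply: uniq_perm; first exact: uniq_filter_parts_upto.
  rewrite map_inj_in_uniq ?uniq_filter_parts_upto // => la mu.
  rewrite !mem_filter_parts_upto => /andP[P1 l1] /andP[P2 l2] eq_f.
  by have [_ _ <-] := PQ _ l1 P1; have [_ _ <-] := PQ _ l2 P2; rewrite eq_f.
move=> la; rewrite mem_filter_parts_upto; apply/andP/mapP => [[Ql ll]|[mu]].
  have [lg Pg fg] := QP _ ll Ql; exists (g la) => //.
  by rewrite mem_filter_parts_upto Pg.
by rewrite mem_filter_parts_upto => /andP[Pm lm] ->; have [] := PQ _ lm Pm.
Qed.

Lemma big_seq_unique (I : eqType) (s : seq I) (P : pred I) i (F : I -> V) :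
    uniq s -> i \in s -> P i -> (forall j, P j -> j = i) ->
  \sum_(j <- s | P j) F j = F i.
Proof.
move=> s_uniq s_i P_i P1; rewrite big_mkcond (bigD1_seq i) //= P_i.
by rewrite big1 ?addr0 // => j; case: ifP => // /P1-> /eqP.
Qed.

Lemma big_parts_unique N (P : pred intpart) (mu : intpart) (F : intpart -> V) :
    (sumn mu <= N)%N -> P mu -> (forall la, P la -> la = mu) ->
  \sum_(la <- parts_upto N | P la) F la = F mu.
Proof.
move=> le_N P_mu P1; apply: big_seq_unique => //; first exact: uniq_parts_upto.
by rewrite mem_parts_upto.
Qed.

End BigParts.

(** * The local bijection between common upper and lower strips *)

Section LocalRule.

Variables (la rho : intpart) (r : nat).

Let top i := maxn (rowlen la i) (rowlen rho i).
Let bot i := minn (rowlen la i) (rowlen rho i).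

(* A row of mu above la and rho and the previous row of nu below them range   *)
(* over the same interval, which is reflected by the bijection.               *)
Let local_down (mu : intpart) : intpart :=
  mkpart (size la + size rho) (fun i => top i.+1 + bot i - rowlen mu i.+1).

(** The inverse reflection. The first row is bounded by no row above it: its excess over [top 0] is
    the one that makes the size of the result |la| + r, by [local_rule_sumn]. *)
Let local_up (nu : intpart) : intpart :=
  mkpart (size la + size rho).+1
    (fun i => if i is i'.+1 then top i + bot i' - rowlen nu i'
              else top 0 + (sumn nu + r - sumn rho)).

Let bot0 : bot (size la + size rho) = 0.
Proof. by rewrite /bot rowlen_default ?leq_addr // min0n. Qed.

(** As [top i + bot i] is the sum of the i-th rows of la and rho, adding up the relations over all
    rows compares the sizes. *)
Lemma local_rule_sumn (mu nu : intpart) d :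
    rowlen mu 0 = top 0 + d ->
    (forall i, rowlen mu i.+1 + rowlen nu i = top i.+1 + bot i) ->
  sumn mu + sumn nu = sumn la + sumn rho + d.
Proof.
move=> mu0 muS.
have [L [leL1 leL2 leL3 leL4]] : exists L,
  [/\ size mu <= L, size nu <= L, size la <= L & size rho <= L].
  by exists (size mu + size nu + size la + size rho); split; lia.
rewrite (sumn_rowlen (leqW leL1)) (sumn_rowlen leL2).
rewrite (sumn_rowlen leL3) (sumn_rowlen leL4) big_ord_recl mu0 /=.
have -> : \sum_(i < L) rowlen la i + \sum_(i < L) rowlen rho i
        = \sum_(i < L) top i + \sum_(i < L) bot i.
  by rewrite -!big_split; apply: eq_bigr => i _; rewrite /top /bot /=; lia.
have <- : top 0 + \sum_(i < L) top i.+1 = \sum_(i < L) top i.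
  transitivity (\sum_(i < L.+1) top i); first by rewrite big_ord_recl.
  by rewrite big_ord_recr /= [X in _ + X]/top !rowlen_default // maxnn addn0.
have : \sum_(i < L) rowlen mu (bump 0 i) + \sum_(i < L) rowlen nu i
     = \sum_(i < L) top i.+1 + \sum_(i < L) bot i.
  by rewrite -!big_split; apply: eq_bigr => i _; apply: muS.
by move=> e; rewrite -addnA e addnAC addnA addnAC.
Qed.

Lemma local_downP mu : hstrip la mu -> hstrip rho mu ->
  [/\ forall i, rowlen mu i.+1 + rowlen (local_down mu) i = top i.+1 + bot i,
      hstrip (local_down mu) la & hstrip (local_down mu) rho].
Proof.
move=> /hstripP la_mu /hstripP rho_mu.
have mu_ge i : top i <= rowlen mu i.
  by have := la_mu i; have := rho_mu i; rewrite /top; lia.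
have mu_le i : rowlen mu i.+1 <= bot i.
  by have := la_mu i; have := rho_mu i; rewrite /bot; lia.
have bot_le i : bot i <= top i by rewrite /bot /top; lia.
have top_anti i j : i <= j -> top j <= top i.
  by move=> /[dup] /(rowlen_anti la) ? /(rowlen_anti rho) ?; rewrite /top; lia.
pose f i := top i.+1 + bot i - rowlen mu i.+1.
have f_bounds i : top i.+1 <= f i <= bot i.
  by have := mu_ge i.+1; have := mu_le i; rewrite /f; lia.
have nuE : rowlen (local_down mu) =1 f.
  apply: (rowlen_mkpart (f := f)) => [i j|]; last first.
    have /andP[_] := f_bounds (size la + size rho).
    by rewrite bot0 leqn0 => /eqP.
  rewrite leq_eqVlt => /predU1P[-> //|lt_ij].
  have := top_anti _ _ lt_ij; have := bot_le j.
  by have := f_bounds i; have := f_bounds j; lia.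
have f_la i := f_bounds i.
split=> [i||].
- by rewrite nuE /f; have := mu_le i; have := mu_ge i.+1; lia.
- by apply/hstripP => i; rewrite nuE; have := f_la i; rewrite /top /bot; lia.
- by apply/hstripP => i; rewrite nuE; have := f_la i; rewrite /top /bot; lia.
Qed.

Lemma local_upP nu : hstrip nu la -> hstrip nu rho ->
  [/\ rowlen (local_up nu) 0 = top 0 + (sumn nu + r - sumn rho),
      forall i, rowlen (local_up nu) i.+1 + rowlen nu i = top i.+1 + bot i,
      hstrip la (local_up nu) & hstrip rho (local_up nu)].
Proof.
move=> /hstripP la_nu /hstripP rho_nu.
have nu_ge i : top i.+1 <= rowlen nu i.
  by have := la_nu i; have := rho_nu i; rewrite /top; lia.
have nu_le i : rowlen nu i <= bot i.
  by have := la_nu i; have := rho_nu i; rewrite /bot; lia.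
have bot_anti i j : i <= j -> bot j <= bot i.
  by move=> /[dup] /(rowlen_anti la) ? /(rowlen_anti rho) ?; rewrite /bot; lia.
pose f i := if i is i'.+1 then top i + bot i' - rowlen nu i'
            else top 0 + (sumn nu + r - sumn rho).
have f_top i : top i <= f i.
  case: i => [|i] /=; first exact: leq_addr.
  by have := nu_ge i; have := nu_le i; lia.
have f_bot i : f i.+1 <= bot i.
  by rewrite /f; have := nu_ge i; have := nu_le i; lia.
have bot_le i : bot i <= top i by rewrite /bot /top; lia.
have muE : rowlen (local_up nu) =1 f.
  apply: (rowlen_mkpart (f := f)) => [i j|]; last first.
    have := f_bot (size la + size rho).
    by rewrite bot0 leqn0 => /eqP.
  rewrite leq_eqVlt => /predU1P[-> //|].
  case: j => // j le_ij.
  have := bot_anti i j le_ij; have := bot_le i.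
  by have := f_top i; have := f_bot j; lia.
split=> [|i||]; rewrite ?muE //.
- by rewrite /f; have := nu_le i; have := nu_ge i; lia.
- apply/hstripP => i; rewrite !muE; have := f_top i; have := f_bot i.
  by rewrite /top /bot; lia.
- apply/hstripP => i; rewrite !muE; have := f_top i; have := f_bot i.
  by rewrite /top /bot; lia.
Qed.

(** The reflections match all rows of mu but the first with the rows of nu. The first row of mu may
    exceed [top 0] by any amount, and that amount is |nu| + r - |rho|, which explains the inequality
    on the right. Summing a constant states that the two sets are equinumerous. *)
Lemma local_rule (V : nmodType) (c : V) N : sumn la + r <= N -> sumn rho <= N ->
  (\sum_(mu <- parts_upto N | [&& hstrip la mu, hstrip rho mu
                               & sumn mu == (sumn la + r)%N]) c
   = \sum_(nu <- parts_upto N | [&& hstrip nu la, hstrip nu rho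
                               & (sumn rho <= sumn nu + r)%N]) c)%R.
Proof.
move=> le_laN le_rhoN; symmetry.
apply: (big_parts_reindex (f := local_down) (g := local_up)).
  move=> mu le_muN /and3P[la_mu rho_mu /eqP mu_sz].
  have [muS nu_la nu_rho] := local_downP la_mu rho_mu.
  have [up0 upS la_up rho_up] := local_upP nu_la nu_rho.
  have [d mu0] : exists d, rowlen mu 0 = top 0 + d.
    exists (rowlen mu 0 - top 0).
    have /hstripP/(_ 0) := la_mu; have /hstripP/(_ 0) := rho_mu.
    by rewrite /top; lia.
  have sz := local_rule_sumn mu0 muS.
  split.
  - by have := hstrip_sumn nu_la; lia.
  - by rewrite nu_la nu_rho; lia.
  - apply: rowlen_inj => -[|i].
      by rewrite up0 mu0; lia.
    by apply/eqP; rewrite -(eqn_add2r (rowlen (local_down mu) i)) upS muS.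
move=> nu le_nuN /and3P[nu_la nu_rho le_rho].
have [up0 upS la_up rho_up] := local_upP nu_la nu_rho.
have [downS _ _] := local_downP la_up rho_up.
have sz := local_rule_sumn up0 upS.
split.
- by lia.
- by rewrite la_up rho_up; lia.
- apply: rowlen_inj => i; apply/eqP.
  by rewrite -(eqn_add2l (rowlen (local_up nu) i.+1)) downS upS.
Qed.

End LocalRule.

(** * Cancellation between horizontal and vertical strips *)

Lemma sumn_set_row (mu mu' : intpart) i0 d :
    rowlen mu' i0 = rowlen mu i0 + d ->
    (forall i, i != i0 -> rowlen mu' i = rowlen mu i) ->
  sumn mu' = sumn mu + d.
Proof.
move=> mu'i0 mu'E.
have [K [le_mu le_mu' lt_i]] :
    exists K, [/\ size mu <= K, size mu' <= K & i0 < K].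
  by exists (size mu + size mu' + i0.+1); split; lia.
rewrite (sumn_rowlen le_mu) (sumn_rowlen le_mu').
rewrite (bigD1 (Ordinal lt_i)) //= [in RHS](bigD1 (Ordinal lt_i)) //= mu'i0.
by rewrite addnAC; congr (_ + _ + _); apply: eq_bigr => i /mu'E.
Qed.

Definition set_row (mu : intpart) (i0 v : nat) : intpart :=
  mkpart (size mu + i0.+1) (fun i => if i == i0 then v else rowlen mu i).

(** The rows of a partition that interlaces with la vary independently, each in its own interval, so
    one of them can be changed alone. *)
Lemma set_row_hstrip (mu la : intpart) i0 v :
    hstrip mu la -> rowlen la i0.+1 <= v <= rowlen la i0 ->
  rowlen (set_row mu i0 v) =1 (fun i => if i == i0 then v else rowlen mu i)
  /\ hstrip (set_row mu i0 v) la.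
Proof.
move=> /hstripP mu_la v_la; set f := fun i => _.
have f_la i : rowlen la i.+1 <= f i <= rowlen la i.
  by rewrite /f; case: eqP => [->|_].
have fE : rowlen (set_row mu i0 v) =1 f.
  apply: (rowlen_mkpart (f := f)) => [i j|].
    rewrite leq_eqVlt => /predU1P[-> //|/(rowlen_anti la)].
    by have := f_la i; have := f_la j; lia.
  by rewrite /f ifN ?rowlen_default //; lia.
by split=> //; apply/hstripP => i; rewrite fE.
Qed.

(** The last such row is chosen because then la_{i0+1} = nu_{i0+1} <= nu_{i0}, so that a row of
    length nu_{i0} is admissible below la. *)
Lemma last_row_diff (la nu : intpart) : la != nu ->
  exists2 i0, rowlen la i0 != rowlen nu i0
            & forall i, i0 < i -> rowlen la i = rowlen nu i.
Proof.
move=> ne; pose P i := rowlen la i != rowlen nu i.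
have exP : exists i, P i.
  have : ~~ all (fun i => ~~ P i) (iota 0 (size la + size nu)).
    apply: contra ne => /allP all_eq; apply/eqP/rowlen_inj => i.
    case: (ltnP i (size la + size nu)) => lt_i; last by rewrite !rowlen_default; lia.
    by apply/eqP; have := all_eq i; rewrite mem_iota negbK => ->.
  by rewrite -has_predC => /hasP[i _ /=]; rewrite negbK; exists i.
have ubP i : P i -> i <= size la + size nu.
  by rewrite /P; apply: contraNT => ?; rewrite !rowlen_default //; lia.
case: (ex_maxnP exP ubP) => i0 Pi0 max_i0; exists i0 => // i lt_i.
by apply/eqP; apply: contraLR lt_i => /max_i0; rewrite -leqNgt.
Qed.

(* Toggling, between its two possible values, the length of the last row on   *)
(* which la and nu differ is a sign-reversing involution.                     *)
Lemma strips_sign_sum (R : comNzRingType) (la nu : intpart) N :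
    (sumn la <= N)%N -> la != nu ->
  (\sum_(mu <- parts_upto N | hstrip mu la && vstrip nu mu)
     (-1) ^+ (sumn mu) = 0 :> R)%R.
Proof.
move=> le_N /last_row_diff[i0 ne_i0 eq_i].
rewrite (bigID (fun mu => rowlen mu i0 == rowlen nu i0)) /=.
set f := fun mu => set_row mu i0 (rowlen nu i0).+1.
set g := fun mu => set_row mu i0 (rowlen nu i0).
have la_nu : rowlen la i0.+1 <= rowlen nu i0 by rewrite eq_i // rowlen_anti.
have fP mu : hstrip mu la -> vstrip nu mu -> rowlen mu i0 = rowlen nu i0 ->
    [/\ rowlen (f mu) =1 fun i => if i == i0 then (rowlen nu i0).+1
                                  else rowlen mu i, hstrip (f mu) la
      & sumn (f mu) = sumn mu + 1].
  move=> mu_la nu_mu mu_i0.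
  have [|fE f_la] := @set_row_hstrip mu la i0 (rowlen nu i0).+1 mu_la.
    have := hstripP _ _ mu_la i0; rewrite mu_i0.
    by have := ne_i0; lia.
  split=> //; apply: (@sumn_set_row _ _ i0) => [|i /negPf ne].
    by rewrite fE eqxx mu_i0 addn1.
  by rewrite fE ne.
rewrite addrC (@big_parts_reindex _ N N
  (fun mu => hstrip mu la && vstrip nu mu && (rowlen mu i0 == rowlen nu i0))
  _ f g) //=; last 2 first.
- move=> mu le_mu /andP[/andP[mu_la nu_mu] /eqP mu_i0].
  have [fE f_la szf] := fP mu mu_la nu_mu mu_i0.
  split; first by apply: leq_trans le_N; apply: hstrip_sumn.
    rewrite f_la fE eqxx -andbA; apply/andP; split=> //; apply/andP; split; last lia.
    apply/vstripP => i; rewrite fE; case: eqP => [->|_]; first lia.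
    exact: (vstripP _ _ nu_mu).
  have [|gE _] := @set_row_hstrip (f mu) la i0 (rowlen nu i0) f_la.
    by rewrite la_nu; have := hstripP _ _ mu_la i0; lia.
  by apply: rowlen_inj => i; rewrite gE fE; case: eqP => // ->.
- move=> mu le_mu /andP[/andP[mu_la nu_mu] /eqP mu_i0].
  have := vstripP _ _ nu_mu i0; have := hstripP _ _ mu_la i0 => mu_b nu_b.
  have [|gE g_la] := @set_row_hstrip mu la i0 (rowlen nu i0) mu_la.
    by rewrite la_nu; lia.
  have nu_g : vstrip nu (g mu).
    apply/vstripP => i; rewrite gE; case: eqP => [->|_]; first lia.
    exact: (vstripP _ _ nu_mu).
  have gi0 : rowlen (g mu) i0 = rowlen nu i0 by rewrite gE eqxx.
  have [fE _ _] := fP _ g_la nu_g gi0.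
  split.
  + by apply: leq_trans le_N; apply: hstrip_sumn.
  + by rewrite g_la nu_g gi0 eqxx.
  + by apply: rowlen_inj => i; rewrite fE gE; case: eqP => // ->; lia.
rewrite -big_split big1 //= => mu /andP[/andP[mu_la nu_mu] /eqP mu_i0].
by have [_ _ ->] := fP mu mu_la nu_mu mu_i0; rewrite exprD expr1 mulrN1 addNr.
Qed.

(** * Letter operators and the Pieri rule *)

Section Operators.

Variable R : comNzRingType.
Implicit Types (phi psi : intpart -> R) (x y : R).
Local Open Scope ring_scope.

Definition hop x phi la : R :=
  \sum_(mu <- parts_upto (sumn la) | hstrip mu la)
     x ^+ (sumn la - sumn mu) * phi mu.

Definition vop y phi la : R :=
  \sum_(mu <- parts_upto (sumn la) | vstrip mu la)
     y ^+ (sumn la - sumn mu) * phi mu.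

Definition uop (r : nat) phi la : R :=
  \sum_(mu <- parts_upto (sumn la + r)
         | hstrip la mu && (sumn mu == sumn la + r)%N) phi mu.

Lemma hopE N x phi la : (sumn la <= N)%N ->
  hop x phi la =
    \sum_(mu <- parts_upto N | hstrip mu la) x ^+ (sumn la - sumn mu) * phi mu.
Proof. by move=> le_N; apply: big_parts_widen => // mu /hstrip_sumn. Qed.

Lemma vopE N y phi la : (sumn la <= N)%N ->
  vop y phi la =
    \sum_(mu <- parts_upto N | vstrip mu la) y ^+ (sumn la - sumn mu) * phi mu.
Proof. by move=> le_N; apply: big_parts_widen => // mu /vstrip_sumn. Qed.

Lemma uopE N r phi la : (sumn la + r <= N)%N ->
  uop r phi la =
    \sum_(mu <- parts_upto N | hstrip la mu && (sumn mu == sumn la + r)%N)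
      phi mu.
Proof.
by move=> le_N; apply: big_parts_widen => // mu /andP[_ /eqP->].
Qed.

Lemma eq_hop x phi psi : phi =1 psi -> hop x phi =1 hop x psi.
Proof. by move=> e la; apply: eq_bigr => mu _; rewrite e. Qed.

Lemma eq_uop r phi psi : phi =1 psi -> uop r phi =1 uop r psi.
Proof. by move=> e la; apply: eq_bigr => mu _; rewrite e. Qed.

Lemma hopZ x a phi : hop x (fun la => a * phi la) =1 (fun la => a * hop x phi la).
Proof.
by move=> la; rewrite mulr_sumr; apply: eq_bigr => mu _; rewrite mulrCA.
Qed.

Lemma hop_sum x (I : Type) (s : seq I) (F : I -> intpart -> R) :
  hop x (fun la => \sum_(j <- s) F j la) =1
  (fun la => \sum_(j <- s) hop x (F j) la).
Proof.
move=> la; rewrite exchange_big; apply: eq_bigr => mu _ /=; exact: mulr_sumr.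
Qed.

(** [hop x] is unitriangular for the size: its diagonal coefficient is 1 and all other terms are at
    strictly smaller partitions. *)
Lemma hop_inj x phi psi : hop x phi =1 hop x psi -> phi =1 psi.
Proof.
have hop_split chi la : hop x chi la = chi la +
    \sum_(mu <- parts_upto (sumn la) | hstrip mu la && (mu != la))
       x ^+ (sumn la - sumn mu) * chi mu.
  rewrite /hop (bigID (pred1 la)) /= (@big_parts_unique _ _ _ la) ?subnn ?mul1r //.
    by rewrite hstrip_refl /=.
  by move=> mu /andP[_ /eqP].
move=> eq_h la; have [n] := ubnP (sumn la).
elim: n la => // n IHn la lt_n; have := eq_h la; rewrite !hop_split.
rewrite (eq_bigr (fun mu => x ^+ (sumn la - sumn mu) * psi mu)).
  by move/addIr.
move=> mu /andP[mu_la /eqP mu_ne]; rewrite IHn //.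
rewrite ltnS in lt_n; apply: leq_trans lt_n; rewrite ltnNge.
by apply/negP => /(hstrip_eq mu_la).
Qed.

(** The weight x^(|la| + r - |rho|) depends on the end points la and rho only, so [local_rule] can
    replace the middle partition mu above both by nu below both. The weight then splits as x^(|la| -
    |nu|) times x^j with j = |nu| + r - |rho|. *)
Lemma uop_hop r x phi la :
  uop r (hop x phi) la
    = hop x (fun rho => \sum_(j < r.+1) x ^+ j * uop (r - j) phi rho) la.
Proof.
set N := (sumn la + r)%N.
pose wt rho : R := x ^+ (sumn la + r - sumn rho) * phi rho.
transitivity (\sum_(rho <- parts_upto N)
   \sum_(mu <- parts_upto N | [&& hstrip la mu, hstrip rho mu
                                & sumn mu == (sumn la + r)%N]) wt rho).
  rewrite (exchange_big_dep (fun mu => hstrip la mu && (sumn mu == sumn la + r)%N)) /=;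
    last by move=> rho mu _ /and3P[-> _ ->].
  apply: eq_bigr => mu /andP[la_mu /eqP sz]; rewrite (@hopE N) ?sz //.
  by apply: eq_bigl => rho; rewrite la_mu eqxx andbT.
transitivity (\sum_(rho <- parts_upto N)
   \sum_(nu <- parts_upto N | [&& hstrip nu la, hstrip nu rho
                                & (sumn rho <= sumn nu + r)%N]) wt rho).
  rewrite !big_seq; apply: eq_bigr => rho; rewrite mem_parts_upto => le_rho.
  by rewrite (local_rule _ _ le_rho).
rewrite (exchange_big_dep (fun nu => hstrip nu la)) /=;
  last by move=> rho nu _ /and3P[].
rewrite (@hopE N) ?leq_addr //; apply: eq_bigr => nu nu_la.
rewrite nu_la /= mulr_sumr.
have le_nu := hstrip_sumn nu_la.
transitivity (\sum_(j < r.+1) \sum_(rho <- parts_upto N |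
     hstrip nu rho && (sumn rho == sumn nu + (r - j))%N) wt rho).
  rewrite (exchange_big_dep (fun rho => hstrip nu rho && (sumn rho <= sumn nu + r)%N)) /=;
    last by move=> j rho _ /andP[-> /eqP->]; lia.
  apply: eq_bigr => rho /andP[nu_rho le_rho]; have := hstrip_sumn nu_rho => le_nr.
  have lt_j : (sumn nu + r - sumn rho < r.+1)%N by lia.
  rewrite (bigD1 (Ordinal lt_j)) /= ?nu_rho; last by apply/eqP; lia.
  rewrite big1 ?addr0 // => j /andP[/eqP sz /eqP[]].
  by apply: val_inj => /=; have := ltn_ord j; lia.
apply: eq_bigr => j _; rewrite (@uopE N); last by lia.
rewrite !mulr_sumr; apply: eq_bigr => rho /andP[nu_rho /eqP sz].
rewrite mulrA -exprD /wt; congr (x ^+ _ * _).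
by have := ltn_ord j; lia.
Qed.

(** The identity H(x) E(-x) = 1 at the level of shapes: the coefficient of [phi nu] is, up to a
    factor, the signed count of [strips_sign_sum], which vanishes unless nu = la. *)
Lemma hop_vop x phi : hop x (vop (- x) phi) =1 phi.
Proof.
move=> la; set N := sumn la.
transitivity (\sum_(nu <- parts_upto N) (x ^+ (sumn la - sumn nu)
    * (-1) ^+ sumn nu * phi nu *
    \sum_(mu <- parts_upto N | hstrip mu la && vstrip nu mu) (-1) ^+ sumn mu)).
  under [RHS]eq_bigr do rewrite mulr_sumr.
  rewrite (exchange_big_dep (fun mu => hstrip mu la)) /=;
    last by move=> nu mu _ /andP[].
  apply: eq_bigr => mu mu_la; have le_mu := hstrip_sumn mu_la.
  rewrite (@vopE N) // mulr_sumr mu_la /=; apply: eq_bigr => nu nu_mu.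
  have le_nu := vstrip_sumn nu_mu.
  rewrite [(- x) ^+ _]exprNn (_ : sumn la - sumn nu =
    (sumn la - sumn mu) + (sumn mu - sumn nu))%N; last by lia.
  have -> : (-1) ^+ (sumn mu - sumn nu) = (-1) ^+ sumn nu * (-1) ^+ sumn mu :> R.
    by rewrite -signr_odd oddB // signr_addb !signr_odd mulrC.
  by rewrite exprD; ring.
rewrite (bigD1_seq la) ?mem_parts_upto //=; last exact: uniq_parts_upto.
rewrite [X in _ + X]big1 ?addr0 => [|nu ne_nu]; last first.
  by rewrite strips_sign_sum ?mulr0 // eq_sym.
rewrite (@big_parts_unique _ _ _ la) ?hstrip_refl //.
- by rewrite subnn mul1r mulrAC -exprD addnn -muln2 exprM sqrr_sign mul1r.
- by apply/vstripP => i; rewrite leqnn leqnSn.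
move=> mu /andP[mu_la /vstrip_sumn]; exact: hstrip_eq.
Qed.

(* A letter (b, x) is primed iff b; the head of a word is its largest letter. *)
Definition letter_op (a : bool * R) : (intpart -> R) -> intpart -> R :=
  if a.1 then vop a.2 else hop a.2.

Definition word_fun (w : seq (bool * R)) : intpart -> R :=
  foldr letter_op (fun la => (la == empty_part)%:R) w.

(** This is what a multiplicative evaluation of the Schur functions satisfies, with [c r] the value
    of h_r. *)
Definition is_pieri phi (c : nat -> R) : Prop :=
  forall r la, uop r phi la = c r * phi la.

(** The generating series of c is multiplied by 1 / (1 - x t). *)
Lemma pieri_hop x phi c : is_pieri phi c ->
  is_pieri (hop x phi) (fun r => \sum_(j < r.+1) x ^+ j * c (r - j)%N).
Proof.
move=> pieri r la; rewrite uop_hop -hopZ; apply: eq_hop => rho.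
by rewrite mulr_suml; apply: eq_bigr => j _; rewrite pieri mulrA.
Qed.

(** The generating series of c is multiplied by 1 + y t. As [hop (- y)] undoes [vop y], this is
    [uop_hop] solved for the unknown side, and injectivity of [hop (- y)] transfers the result
    back. *)
Lemma pieri_vop y phi c : is_pieri phi c ->
  is_pieri (vop y phi) (fun r => c r + y * (if r is s.+1 then c s else 0)).
Proof.
move=> pieri; have vK : hop (- y) (vop y phi) =1 phi.
  by move=> la; have := hop_vop (- y) phi la; rewrite opprK.
pose G k := hop (- y) (uop k (vop y phi)).
have G_sum r la : c r * phi la = \sum_(j < r.+1) (- y) ^+ j * G (r - j)%N la.
  rewrite -pieri -(eq_uop r vK) uop_hop hop_sum.
  by apply: eq_bigr => j _; rewrite hopZ.
move=> r; apply: (@hop_inj (- y)) => la; rewrite hopZ vK -/(G r la).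
(* The term j = 0 is [G r la]; the other terms add up to -y times the same sum for r - 1. *)
have := G_sum r la; rewrite big_ord_recl mul1r subn0 => Gr.
case: r Gr => [|r] Gr; first by rewrite mulr0 addr0 Gr big_ord0 addr0.
rewrite mulrDl Gr -mulrA G_sum mulr_sumr -addrA -big_split big1 ?addr0 // => j _.
by rewrite /= subSS exprS; ring.
Qed.

Lemma pieri_word w : exists c, is_pieri (word_fun w) c.
Proof.
elim: w => [|[[] x] w [c pieri]].
- exists (fun r => (r == 0%N)%:R) => r la; rewrite /word_fun /=.
  have [->|r_gt0] := posnP r.
    rewrite mul1r (@uopE (sumn la)) ?addn0 //.
    rewrite (@big_parts_unique _ _ _ la) // ?hstrip_refl ?eqxx //.
    move=> mu /andP[la_mu /eqP sz]; apply/esym/(hstrip_eq la_mu); lia.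
  rewrite mul0r /uop big1 // => mu /andP[_ /eqP sz].
  by rewrite -sumn_eq0; case: eqP => //; lia.
- by exists (fun r => c r + x * (if r is s.+1 then c s else 0)); apply: pieri_vop.
- by exists (fun r => \sum_(j < r.+1) x ^+ j * c (r - j)%N); apply: pieri_hop.
Qed.

End Operators.

(** * Triangularity with respect to the first row *)

Fact is_part_behead (la : intpart) : is_part (behead la).
Proof.
case: la => -[|x s] //= /andP[/path_sorted s_sorted].
by rewrite inE negb_or /is_part s_sorted => /andP[].
Qed.

Definition behead_part la := IntPart (is_part_behead la).

Lemma rowlen_behead la i : rowlen (behead_part la) i = rowlen la i.+1.
Proof. exact: nth_behead. Qed.

Lemma sumn_behead (la : intpart) : sumn la = rowlen la 0 + sumn (behead_part la).
Proof. by case: la => -[|x s]. Qed.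

Lemma hstrip_behead la : hstrip (behead_part la) la.
Proof. by apply/hstripP => i; rewrite rowlen_behead leqnn rowlen_anti. Qed.

(* Among the ways to add a horizontal strip of size la_0 to la minus its      *)
(* first row, la is the one with the shortest first row.                      *)
Lemma hstrip_behead_le la mu :
    hstrip (behead_part la) mu -> sumn mu = sumn la ->
  rowlen la 0 <= rowlen mu 0 ?= iff (mu == la).
Proof.
move=> /hstripP la_mu sz.
have le_mu i : rowlen (behead_part mu) i <= rowlen (behead_part la) i.
  by rewrite rowlen_behead; case/andP: (la_mu i).
have := sumn_le le_mu; have := sumn_behead la; have := sumn_behead mu.
rewrite sz => sz_mu sz_la le_sz; split; first by lia.
apply/eqP/eqP => [eq0|-> //]; have : behead_part mu = behead_part la.
  by apply: sumn_le_eq => //; lia.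
move=> eq_b; apply: rowlen_inj => -[|i] //.
by rewrite -!rowlen_behead eq_b.
Qed.

Section FirstRow.
Variable (V : nmodType).
Local Open Scope ring_scope.

(** The Pieri expansion of h_{la_0} times S of la without its first row. It lets S_la be solved for,
    both to multiply and to prove independence. *)
Lemma big_hstrip_behead la N (F : intpart -> V) : (sumn la <= N)%N ->
  \sum_(mu <- parts_upto N | hstrip (behead_part la) mu
                             && (sumn mu == sumn la)%N) F mu =
  F la + \sum_(mu <- parts_upto N | [&& hstrip (behead_part la) mu,
             (sumn mu == sumn la)%N & (rowlen la 0 < rowlen mu 0)%N]) F mu.
Proof.
move=> le_N; rewrite (bigID (pred1 la)) /=; congr (_ + _).
  rewrite (@big_parts_unique _ _ _ la) ?hstrip_behead ?eqxx //.
  by move=> mu /andP[_ /eqP].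
apply: eq_bigl => mu; rewrite -andbA; case la_mu: hstrip => //=.
case: eqP => //= sz; have [le_r <-] := hstrip_behead_le la_mu sz.
by rewrite ltn_neqAle le_r andbT.
Qed.

End FirstRow.

(** * Products valid in all words at once *)

Section Products.
Local Open Scope ring_scope.

(** Lists with possible repetitions are easier to concatenate and expand than finitely supported
    functions; [symfun_of_comb] converts at the end. *)
Definition comb (R : comAlgType rat) (w : seq (bool * R))
    (s : seq (rat * intpart)) : R :=
  \sum_(a <- s) a.1 *: word_fun w a.2.

Lemma comb_cat (R : comAlgType rat) (w : seq (bool * R)) s t :
  comb w (s ++ t) = comb w s + comb w t.
Proof. exact: big_cat. Qed.

Lemma comb_cons (R : comAlgType rat) (w : seq (bool * R)) a s :
  comb w (a :: s) = a.1 *: word_fun w a.2 + comb w s.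
Proof. exact: big_cons. Qed.

Lemma comb_scale (R : comAlgType rat) (w : seq (bool * R)) c s :
  comb w [seq (c * a.1, a.2) | a <- s] = c *: comb w s.
Proof.
by rewrite /comb big_map scaler_sumr; apply: eq_bigr => a _; rewrite scalerA.
Qed.

Lemma word_fun_empty (R : comNzRingType) (w : seq (bool * R)) :
  word_fun w empty_part = 1.
Proof.
elim: w => [|[b x] w IHw] //=; rewrite /letter_op /=.
have le0 mu : (sumn mu <= sumn empty_part)%N -> mu = empty_part.
  by rewrite leqn0 sumn_eq0 => /eqP.
case: b; rewrite /vop /hop (@big_parts_unique _ _ _ empty_part) //.
- by rewrite IHw mul1r.
- by move=> mu /vstrip_sumn/le0.
- by rewrite IHw mul1r.
- by move=> mu /hstrip_sumn/le0.
Qed.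

Definition pieri_comb (r : nat) (s : seq (rat * intpart)) :=
  flatten [seq [seq (a.1, mu) | mu <- parts_upto (sumn a.2 + r)
                  & hstrip a.2 mu && (sumn mu == sumn a.2 + r)%N] | a <- s].

Lemma comb_pieri r s (R : comAlgType rat) (w : seq (bool * R)) c :
  is_pieri (word_fun w) c -> comb w (pieri_comb r s) = c r * comb w s.
Proof.
move=> pieri; rewrite /comb /pieri_comb big_flatten big_map mulr_sumr.
apply: eq_bigr => a _; rewrite big_map big_filter -scalerAr -pieri scaler_sumr.
by [].
Qed.

(** The combination t is chosen before the ring and the word, which makes the product universal. The
    recursion solves the first-row expansion for S_la: removing the first row lowers the size, and
    the other terms keep the size but lower |la| - la_0. *)
Lemma comb_mul_word la s : exists t,
  forall (R : comAlgType rat) (w : seq (bool * R)),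
    comb w t = word_fun w la * comb w s.
Proof.
have [n] := ubnP (sumn la); elim: n la => // n IHn la lt_n.
have [k] := ubnP (sumn la - rowlen la 0).
elim: k la lt_n => // k IHk la lt_n lt_k.
have [->|ne0] := eqVneq la empty_part.
  by exists s => R w; rewrite word_fun_empty mul1r.
have sz := sumn_behead la.
have r_gt0 : (0 < rowlen la 0)%N.
  by move: ne0; rewrite -sumn_eq0 sz rowlen_gt0; case: (la) => -[].
have [|t0 t0E] := IHn (behead_part la); first lia.
pose P mu := [&& hstrip (behead_part la) mu,
             (sumn mu == sumn la)%N & (rowlen la 0 < rowlen mu 0)%N].
have [t1 t1E] : exists t1, forall (R : comAlgType rat) (w : seq (bool * R)),
    comb w t1 = (\sum_(mu <- parts_upto (sumn la) | P mu) word_fun w mu) * comb w s.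
  elim: (parts_upto _) => [|mu l [t tE]].
    by exists [::] => R w; rewrite /comb !big_nil mul0r.
  case P_mu: (P mu); last by exists t => R w; rewrite tE big_cons P_mu.
  case/and3P: P_mu (P_mu) => _ /eqP sz_mu lt_mu P_mu.
  have [||t' t'E] := IHk mu; [by rewrite sz_mu|by have := rowlen_le_sumn mu 0; lia|].
  by exists (t' ++ t) => R w; rewrite comb_cat tE t'E big_cons P_mu mulrDl.
exists (pieri_comb (rowlen la 0) t0 ++ [seq (-1 * a.1, a.2) | a <- t1]) => R w.
have [c pieri] := pieri_word w.
rewrite comb_cat comb_scale scaleN1r t1E (comb_pieri _ _ pieri) t0E mulrA -pieri -mulrBl.
congr (_ * _); rewrite /uop addnC -sz big_hstrip_behead //.
exact: addrK.
Qed.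

Lemma comb_mul s1 s2 : exists t,
  forall (R : comAlgType rat) (w : seq (bool * R)),
    comb w t = comb w s1 * comb w s2.
Proof.
elim: s1 => [|[a la] s1 [t tE]].
  by exists [::] => R w; rewrite /comb big_nil mul0r.
have [t' t'E] := comb_mul_word la [seq (a * b.1, b.2) | b <- s2].
exists (t' ++ t) => R w; rewrite comb_cat tE t'E comb_scale comb_cons mulrDl.
by rewrite -scalerAl -scalerAr.
Qed.

Definition symfun_comb (R : comAlgType rat) (w : seq (bool * R)) (m : symfun) : R :=
  \sum_(la <- finsupp m) m la *: word_fun w la.

Lemma symfun_of_comb s : exists m : symfun,
  forall (R : comAlgType rat) (w : seq (bool * R)), symfun_comb w m = comb w s.
Proof.
pose S : {fset intpart} := [fset la | la in [seq a.2 | a <- s]]%fset.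
pose F la := \sum_(a <- s | a.2 == la) a.1.
exists [fsfun la in S => F la] => R w.
(* The inclusion may be strict, since collected coefficients can cancel. *)
have subS : (finsupp [fsfun la in S => F la | 0%R] `<=` S)%fset.
  exact: finsupp_sub.
rewrite /symfun_comb (big_fset_incl _ subS); last first.
  by move=> la _ /fsfun_dflt->; rewrite scale0r.
transitivity (\sum_(la <- S) \sum_(a <- s | a.2 == la) a.1 *: word_fun w a.2).
  rewrite !big_seq; apply: eq_bigr => la S_la; rewrite fsfunE S_la scaler_suml.
  by apply: eq_bigr => a /eqP->.
rewrite (exchange_big_dep xpredT) //= /comb [RHS]big_seq big_seq.
apply: eq_bigr => a s_a; rewrite (big_seq_unique (i := a.2)) ?fset_uniq //.
  by rewrite !inE; apply: map_f.
by move=> la /eqP.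
Qed.

End Products.

(** * Conjugate partitions *)

(** In a decreasing list the entries above j form a prefix. *)
Lemma count_ltn_sorted j i (s : seq nat) : sorted geq s ->
  (i < count (fun p => j < p) s) = (j < nth 0 s i).
Proof.
elim: s i => [|x s IHs] i s_sorted; first by rewrite nth_nil.
have IH := IHs _ (path_sorted s_sorted).
rewrite /=; case: (ltnP j x) => [lt_j|le_j]; first by case: i.
have s_le : all (fun p => p <= x) s.
  by apply: (order_path_min _ s_sorted) => a b c /= ba cb; apply: leq_trans ba.
have -> : count (fun p => j < p) s = 0.
  apply/eqP; rewrite -leqn0 leqNgt -has_count -all_predC.
  by apply: sub_all s_le => p /= le_p; rewrite -leqNgt; apply: leq_trans le_j.
rewrite add0n ltn0; apply/esym/negbTE; rewrite -leqNgt; case: i => //= i.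
case: (ltnP i (size s)) => [lt_i|?]; last by rewrite nth_default.
exact: leq_trans (all_nthP 0 s_le i lt_i) le_j.
Qed.

(** Transposition of the diagram cell by cell, the form in which conjugation is used from here
    on. *)
Lemma ltn_rowlen_conj la i j :
  (i < rowlen (conj_part la) j) = (j < rowlen la i).
Proof.
have la_sorted : sorted geq la by case: la => s /= /andP[].
rewrite {1}/rowlen /= /conj_seq; case: (ltnP j (head 0 la)) => [lt_j|le_j].
  by rewrite nth_mkseq // count_ltn_sorted.
rewrite nth_default ?size_mkseq // ltn0; apply/esym/negbTE; rewrite -leqNgt.
by apply: leq_trans le_j; rewrite -nth0; apply: rowlen_anti.
Qed.

Lemma leq_ltn_ext a b : (forall i, i < a -> i < b) -> a <= b.
Proof. by case: a => // a; apply. Qed.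

Lemma conj_partK : involutive conj_part.
Proof.
move=> la; apply: rowlen_inj => i; apply/eqP; rewrite eqn_leq.
by apply/andP; split; apply: leq_ltn_ext => j; rewrite !ltn_rowlen_conj.
Qed.

Lemma sum_ltn_ord M a : a <= M -> \sum_(j < M) (j < a) = a.
Proof.
move=> le_a; rewrite -[RHS]card_ord -sum1_card (big_ord_widen _ (fun=> 1) le_a).
by rewrite [RHS]big_mkcond; apply: eq_bigr => j _; case: ltnP.
Qed.

(** The cells are counted by rows and by columns inside an M by M box. *)
Lemma sumn_conj la : sumn (conj_part la) = sumn la.
Proof.
have [M [le1 le2 le3 le4]] : exists M, [/\ size la <= M, size (conj_part la) <= M,
    forall i, rowlen la i <= M & forall i, rowlen (conj_part la) i <= M].
  exists (size la + size (conj_part la) + sumn la + sumn (conj_part la)).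
  split; [lia|lia| |] => i.
    by have := rowlen_le_sumn la i; lia.
  by have := rowlen_le_sumn (conj_part la) i; lia.
rewrite (sumn_rowlen le1) (sumn_rowlen le2).
under eq_bigr => i _ do rewrite -(sum_ltn_ord (le4 i)).
under [RHS]eq_bigr => i _ do rewrite -(sum_ltn_ord (le3 i)).
rewrite exchange_big; apply: eq_bigr => i _; apply: eq_bigr => j _.
by rewrite ltn_rowlen_conj.
Qed.

Lemma hstrip_conj mu la : hstrip (conj_part mu) (conj_part la) = vstrip mu la.
Proof.
apply/hstripP/vstripP => strip i; apply/andP; split; apply: leq_ltn_ext => j.
- rewrite -!(ltn_rowlen_conj _ i); case/andP: (strip j) => _ le lt.
  exact: leq_trans lt le.
- case: j => // j; rewrite ltnS -!(ltn_rowlen_conj _ i).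
  by case/andP: (strip j) => le _ lt; apply: leq_trans lt le.
- by rewrite !ltn_rowlen_conj; have := strip j; lia.
- by rewrite !ltn_rowlen_conj; have := strip j; lia.
Qed.

Lemma vstrip_conj mu la : vstrip (conj_part mu) (conj_part la) = hstrip mu la.
Proof. by rewrite -hstrip_conj !conj_partK. Qed.

Section Conjugation.
Variable R : comNzRingType.
Local Open Scope ring_scope.

Definition flip_word (w : seq (bool * R)) := [seq (~~ a.1, a.2) | a <- w].

(** Transposition exchanges horizontal and vertical strips, hence the roles of unprimed and primed
    letters. *)
Lemma word_fun_conj (w : seq (bool * R)) la :
  word_fun (flip_word w) la = word_fun w (conj_part la).
Proof.
elim: w la => [|[b x] w IHw] la /=.
  by rewrite -!sumn_eq0 sumn_conj.
have conj_sum (P Q : rel intpart) :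
    (forall mu, P mu la = Q (conj_part mu) (conj_part la)) ->
  \sum_(mu <- parts_upto (sumn la) | P mu la)
     x ^+ (sumn la - sumn mu) * word_fun (flip_word w) mu =
  \sum_(mu <- parts_upto (sumn (conj_part la)) | Q mu (conj_part la))
     x ^+ (sumn (conj_part la) - sumn mu) * word_fun w mu.
  move=> PQ; rewrite sumn_conj.
  rewrite [RHS](@big_parts_reindex _ (sumn la) _ (P^~ la) _ conj_part conj_part).
  - by apply: eq_bigr => mu _; rewrite IHw sumn_conj.
  - by move=> mu le_mu P_mu; rewrite conj_partK sumn_conj -PQ.
  - by move=> mu le_mu Q_mu; rewrite conj_partK sumn_conj PQ conj_partK.
by case: b; apply: conj_sum => mu; rewrite ?hstrip_conj ?vstrip_conj.
Qed.

End Conjugation.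

(** * Linear independence of Schur polynomials *)

Section Independence.
Local Open Scope ring_scope.

Definition unprimed (R : Type) (w : seq R) : seq (bool * R) :=
  [seq (false, x) | x <- w].

(** A polynomial of degree less than N with the N distinct roots 0, ..., N-1 is zero. *)
Lemma sum_exp_eq0 (N : nat) (a : 'I_N -> rat) :
  (forall x, \sum_(r < N) x ^+ r * a r = 0) -> forall r, a r = 0.
Proof.
move=> sum0 r; pose f i := if insub i is Some j then a j else 0.
pose p := \poly_(i < N) f i.
have f_ord (j : 'I_N) : f j = a j by rewrite /f valK.
have p0 : p = 0.
  apply: (@roots_geq_poly_eq0 _ p [seq i%:R | i <- iota 0 N]).
  - apply/allP => x _; apply/rootP; rewrite horner_poly -[RHS](sum0 x).
    by apply: eq_bigr => j _; rewrite f_ord mulrC.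
  - by rewrite map_inj_uniq ?iota_uniq //; apply: (@Num.Theory.mulrIn rat 1).
  - by rewrite size_map size_iota size_poly.
by rewrite -f_ord; have := coef_poly N f r; rewrite -/p p0 coef0 ltn_ord.
Qed.

(* The coefficient of x^r in the last variable gives a relation between       *)
(* partitions of smaller size; the partition with first row r occurs in it    *)
(* only with partitions whose first row is longer.                            *)
Lemma word_fun_free (N : nat) (d : intpart -> rat) :
    (forall w : seq rat,
       \sum_(la <- parts_upto N) d la * word_fun (unprimed w) la = 0) ->
  forall la, (sumn la <= N)%N -> d la = 0.
Proof.
have [n] := ubnP N; elim: n N d => // n IHn N d lt_n d0.
pose D r mu := \sum_(la <- parts_upto N | hstrip mu la
                        && (sumn la == sumn mu + r)%N) d la.
have D0 (w : seq rat) (r : 'I_N.+1) :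
    \sum_(mu <- parts_upto N) D r mu * word_fun (unprimed w) mu = 0.
  move: r; apply: sum_exp_eq0 => x; rewrite -[RHS](d0 (x :: w)).
  transitivity (\sum_(la <- parts_upto N) \sum_(mu <- parts_upto N | hstrip mu la)
      d la * (x ^+ (sumn la - sumn mu) * word_fun (unprimed w) mu)); last first.
    rewrite big_seq [RHS]big_seq; apply: eq_bigr => la.
    by rewrite mem_parts_upto -mulr_sumr => le_N; rewrite -hopE.
  rewrite (exchange_big_dep xpredT) //=.
  under eq_bigr do rewrite mulr_sumr.
  rewrite exchange_big /=; apply: eq_bigr => mu _.
  under eq_bigr => r _ do rewrite /D mulr_suml mulr_sumr.
  rewrite (exchange_big_dep (fun la => hstrip mu la)) /=;
    last by move=> r la _ /andP[].
  rewrite big_seq_cond [RHS]big_seq_cond; apply: eq_bigr => la.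
  rewrite mem_parts_upto => /andP[le_N mu_la]; have le_mu := hstrip_sumn mu_la.
  have lt_r : (sumn la - sumn mu < N.+1)%N by lia.
  rewrite (bigD1 (Ordinal lt_r)) /= ?mu_la; last by apply/eqP; lia.
  rewrite big1 ?addr0 => [|r /andP[/eqP sz /eqP[]]]; first by ring.
  by apply: val_inj => /=; lia.
(* For r > 0 the induction hypothesis applies at N - 1: if |nu| >= N, then [D r nu] is an empty sum,
   as a larger partition would exceed N. *)
have D_eq0 r mu : (0 < r)%N -> (sumn mu + r <= N)%N -> D r mu = 0.
  move=> r_gt0 le_N; apply: (IHn N.-1 (D r)); [lia| |lia] => w.
  have lt_r : (r < N.+1)%N by lia.
  rewrite -[RHS](D0 w (Ordinal lt_r)) /=.
  rewrite [RHS](bigID (fun mu => (sumn mu <= N.-1)%N)) /= [X in _ + X]big1 ?addr0.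
    rewrite -(@big_parts_widen _ _ _ _ _ (leq_pred N)) // big_seq [RHS]big_seq_cond.
    by apply: eq_bigl => nu; rewrite mem_parts_upto andbb.
  move=> nu lt_nu; rewrite /D big_seq_cond big1 ?mul0r // => la.
  by rewrite mem_parts_upto => /and3P[]; lia.
(* Longer first rows are treated before shorter ones. The empty partition is handled apart, by
   evaluating at the empty word, where all other terms vanish. *)
move=> la; have [k] := ubnP (N - rowlen la 0); elim: k la => // k IHk la lt_k le_N.
have [->|ne0] := eqVneq la empty_part.
  have := d0 [::]; rewrite (bigD1_seq empty_part) ?mem_parts_upto //=;
    last exact: uniq_parts_upto.
  by rewrite mulr1 big1 ?addr0 // => mu /negPf->; rewrite mulr0.
have sz := sumn_behead la.
have r_gt0 : (0 < rowlen la 0)%N.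
  by move: ne0; rewrite -sumn_eq0 sz rowlen_gt0; case: (la) => -[].
have := D_eq0 _ (behead_part la) r_gt0; rewrite addnC -sz => /(_ le_N).
rewrite /D addnC -sz big_hstrip_behead // big1_seq ?addr0 // => mu.
rewrite mem_parts_upto => /andP[/and3P[_ _ lt_mu] le_mu].
by apply: IHk => //; have := rowlen_le_sumn mu 0; lia.
Qed.

End Independence.

(** * Tableaux as functions of two coordinates *)

Lemma cell_inj la (c d : cell la) :
  cell_row c = cell_row d -> cell_col c = cell_col d -> c = d.
Proof.
case: c d => [i j] [i' j']; rewrite /cell_row /cell_col /= => /val_inj eq_i.
by case: _ / eq_i j' => j' /val_inj ->.
Qed.

Lemma ltn_cell_col la (c : cell la) : cell_col c < rowlen la (cell_row c).
Proof. exact: ltn_ord. Qed.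

Lemma cell_exists la i j : j < rowlen la i ->
  {c : cell la | cell_row c = i & cell_col c = j}.
Proof.
move=> lt_j; have lt_i : i < size la by rewrite -rowlen_gt0; lia.
by exists (Tagged (fun i : 'I_(size la) => 'I_(nth 0 la i))
             (Ordinal (lt_j : j < nth 0 la (Ordinal lt_i)))).
Qed.

(** Reading a filling by plain coordinates, with value 0 off the diagram, allows fillings of
    different shapes to be compared despite their dependent types. *)
Definition entry n la (T : filling n la) (i j : nat) : nat :=
  if [pick c : cell la | (cell_row c == i) && (cell_col c == j)] is Some c
  then T c else 0.

Lemma entry_cell n la (T : filling n la) c :
  entry T (cell_row c) (cell_col c) = T c.
Proof.
rewrite /entry; case: pickP => [d /andP[/eqP dr /eqP dc]|/(_ c)].
  by rewrite (cell_inj dr dc).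
by rewrite !eqxx.
Qed.

Definition mkfilling n la (f : nat -> nat -> nat) : filling n.+1 la :=
  [ffun c => inord (f (cell_row c) (cell_col c))].

Lemma entry_mkfilling n la f i j : j < rowlen la i -> f i j <= n ->
  entry (mkfilling n la f) i j = f i j.
Proof.
by move=> /cell_exists[c <- <-] le_n; rewrite entry_cell ffunE inordK.
Qed.

(* The letters below k are unprimed. *)
Definition hook_filling (k n : nat) la (T : filling n la) : bool :=
  [forall c : cell la, forall d : cell la,
     ((cell_row c == cell_row d) && (cell_col c < cell_col d)%N
        ==> (T c <= T d)%N && ((k <= T c) ==> (T c != T d)))
  && ((cell_col c == cell_col d) && (cell_row c < cell_row d)%N
        ==> (T c <= T d)%N && (~~ (k <= T c) ==> (T c != T d)))].

Definition hook_rows (k : nat) la (f : nat -> nat -> nat) : Prop :=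
  forall i j j', j < j' -> j' < rowlen la i ->
    f i j <= f i j' /\ (k <= f i j -> f i j <> f i j').

Definition hook_cols (k : nat) la (f : nat -> nat -> nat) : Prop :=
  forall i i' j, i < i' -> j < rowlen la i' ->
    f i j <= f i' j /\ (f i j < k -> f i j <> f i' j).

Lemma hook_fillingP k n la (T : filling n la) :
  reflect (hook_rows k la (entry T) /\ hook_cols k la (entry T))
          (hook_filling k T).
Proof.
apply: (iffP idP) => [/forallP hook|[rows cols]].
  split=> [i j j' lt_j lt_j'|i i' j lt_i lt_j].
    have [c cr cc] := cell_exists (ltn_trans lt_j lt_j').
    have [d dr dc] := cell_exists lt_j'.
    have /andP[/implyP/(_ _)/andP h _] := forallP (hook c) d.
    have -> : entry T i j = T c by rewrite -cr -cc entry_cell.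
    have -> : entry T i j' = T d by rewrite -dr -dc entry_cell.
    have [|? /implyP ne] := h; first by rewrite cr dr cc dc eqxx.
    by split=> // /ne /eqP ne' /ord_inj.
  have [c cr cc] := cell_exists (leq_trans lt_j (rowlen_anti la (ltnW lt_i))).
  have [d dr dc] := cell_exists lt_j.
  have /andP[_ /implyP/(_ _)/andP h] := forallP (hook c) d.
  have -> : entry T i j = T c by rewrite -cr -cc entry_cell.
  have -> : entry T i' j = T d by rewrite -dr -dc entry_cell.
  have [|? /implyP ne] := h; first by rewrite cr dr cc dc eqxx.
  by split=> //; rewrite ltnNge => /ne /eqP ne' /ord_inj.
apply/forallP => c; apply/forallP => d; apply/andP; split; apply/implyP.
  move=> /andP[/eqP eq_r lt_c].
  have e_c : entry T (cell_row d) (cell_col c) = T c by rewrite -eq_r entry_cell.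
  have [|] := rows (cell_row d) (cell_col c) (cell_col d) lt_c.
    exact: ltn_cell_col.
  rewrite e_c entry_cell => -> ne; apply/implyP => /ne ne'.
  by apply/eqP => eq_T; apply: ne'; rewrite eq_T.
move=> /andP[/eqP eq_c lt_r].
have e_c : entry T (cell_row c) (cell_col d) = T c by rewrite -eq_c entry_cell.
have [|] := cols (cell_row c) (cell_row d) (cell_col d) lt_r.
  exact: ltn_cell_col.
rewrite e_c entry_cell => -> ne; rewrite -ltnNge.
by apply/implyP => /ne ne'; apply/eqP => eq_T; apply: ne'; rewrite eq_T.
Qed.

(** The shape formed by the cells holding the letter n, which is primed exactly when k <= n. *)
Definition letter_strip (k n : nat) : rel intpart :=
  if k <= n then vstrip else hstrip.

Lemma letter_strip_le k n mu la : letter_strip k n mu la ->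
  forall i, rowlen mu i <= rowlen la i.
Proof.
rewrite /letter_strip; case: (k <= n) => [/vstripP|/hstripP] h i;
  by case/andP: (h i).
Qed.

Lemma letter_strip_sumn k n mu la :
  letter_strip k n mu la -> sumn mu <= sumn la.
Proof. by move/letter_strip_le/sumn_le. Qed.

(** The shape of the cells with entry below n. Rows are non-decreasing, so [find] returns the length
    of the prefix of such cells, or the whole row length if no entry reaches n. *)
Definition sublevel (n : nat) la (f : nat -> nat -> nat) : intpart :=
  mkpart (size la) (fun i => find (fun j => n <= f i j) (iota 0 (rowlen la i))).

Section Sublevel.

Variables (k n : nat) (la : intpart) (f : nat -> nat -> nat).
Hypotheses (rows : hook_rows k la f) (cols : hook_cols k la f).
Hypothesis f_le : forall i j, j < rowlen la i -> f i j <= n.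

Let row_len i := find (fun j => n <= f i j) (iota 0 (rowlen la i)).

Let ltn_row_len i j : (j < row_len i) = (j < rowlen la i) && (f i j < n).
Proof.
have le_r : row_len i <= rowlen la i.
  by rewrite -[leqRHS](size_iota 0) find_size.
apply/idP/andP => [lt_j|[lt_j f_lt]].
  have lt_j' : j < rowlen la i by apply: leq_trans le_r.
  split=> //; have := before_find 0 lt_j.
  by rewrite nth_iota // add0n leqNgt => /negbFE.
rewrite ltnNge; apply/negP => le_j.
have has_p : has (fun j => n <= f i j) (iota 0 (rowlen la i)).
  by rewrite has_find size_iota -/(row_len i); lia.
have := nth_find 0 has_p; rewrite -/(row_len i) nth_iota; last lia.
rewrite add0n => f_ge; move: le_j; rewrite leq_eqVlt => /predU1P[eq_j|lt].
  by move: f_lt; rewrite -eq_j; lia.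
by have [] := rows lt lt_j; lia.
Qed.

Lemma ltn_sublevel i j :
  (j < rowlen (sublevel n la f) i) = (j < rowlen la i) && (f i j < n).
Proof.
rewrite -ltn_row_len (rowlen_mkpart (f := row_len)) // => [i1 i2|].
  rewrite leq_eqVlt => /predU1P[-> //|lt_i]; apply: leq_ltn_ext => j1.
  rewrite !ltn_row_len => /andP[lt_j f_lt].
  have [le_f _] := cols lt_i lt_j.
  by rewrite (leq_trans lt_j (rowlen_anti la (ltnW lt_i))); lia.
by rewrite /row_len rowlen_default.
Qed.

(** All cells removed hold exactly n, and equal entries are forbidden along a row if n is primed,
    along a column otherwise. *)
Lemma sublevel_strip : letter_strip k n (sublevel n la f) la.
Proof.
have sub_le i : rowlen (sublevel n la f) i <= rowlen la i.
  by apply: leq_ltn_ext => j; rewrite ltn_sublevel => /andP[].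
rewrite /letter_strip; case: leqP => [le_k|lt_k].
  apply/vstripP => i; rewrite sub_le /=; apply: leq_ltn_ext => -[//|j] lt_j.
  rewrite ltnS ltn_sublevel (ltnW lt_j) /= ltnNge; apply/negP => ge_n.
  have [le_f ne] := rows (ltnSn j) lt_j.
  by have le_n := f_le lt_j; apply: ne; lia.
apply/hstripP => i; rewrite sub_le andbT; apply: leq_ltn_ext => j lt_j.
have [le_f ne] := cols (ltnSn i) lt_j.
have lt_j' := leq_trans lt_j (rowlen_anti la (leqnSn i)).
rewrite ltn_sublevel lt_j' /= ltnNge; apply/negP => ge_n.
by have le_n := f_le lt_j; have le_n' := f_le lt_j'; apply: ne; lia.
Qed.

End Sublevel.

(** The converse of [sublevel_strip]: two new cells of one row both hold n, which the strip allows
    only if n is unprimed, and dually for columns. *)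
Lemma hook_extend k n mu la (f : nat -> nat -> nat) :
    letter_strip k n mu la -> hook_rows k mu f -> hook_cols k mu f ->
    (forall i j, j < rowlen la i -> (f i j < n) = (j < rowlen mu i)) ->
    (forall i j, j < rowlen la i -> f i j <= n) ->
  hook_rows k la f /\ hook_cols k la f.
Proof.
move=> strip rows cols f_lt f_le; have mu_la := letter_strip_le strip.
split=> [i j j' lt_j lt_j'|i i' j lt_i lt_j].
  have lt_j2 := ltn_trans lt_j lt_j'.
  have := f_lt _ _ lt_j'; have := f_lt _ _ lt_j2.
  have := f_le _ _ lt_j'; have := f_le _ _ lt_j2.
  case: (ltnP j' (rowlen mu i)) => [lt_mu _ _ _ _|]; first exact: rows.
  case: (ltnP j (rowlen mu i)) => [|ge_j ge_j' ? ? ? ?]; first lia.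
  suff : n < k by lia.
  rewrite ltnNge; apply/negP => le_k; move: strip; rewrite /letter_strip le_k.
  by move/vstripP/(_ i); lia.
have lt_j2 := leq_trans lt_j (rowlen_anti la (ltnW lt_i)).
have := f_lt _ _ lt_j; have := f_lt _ _ lt_j2.
have := f_le _ _ lt_j; have := f_le _ _ lt_j2.
case: (ltnP j (rowlen mu i')) => [lt_mu _ _ _ _|]; first exact: cols.
case: (ltnP j (rowlen mu i)) => [|ge_i ge_i' ? ? ? ?]; first lia.
suff : k <= n by lia.
rewrite leqNgt; apply/negP => lt_k; move: strip; rewrite /letter_strip leqNgt lt_k.
by move/hstripP/(_ i); have := rowlen_anti la lt_i; lia.
Qed.

Lemma hook_restrict k mu la (f : nat -> nat -> nat) :
    (forall i, rowlen mu i <= rowlen la i) ->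
  hook_rows k la f -> hook_cols k la f -> hook_rows k mu f /\ hook_cols k mu f.
Proof.
move=> mu_la rows cols; split=> [i j j' lt_j lt_j'|i i' j lt_i lt_j].
  by apply: rows => //; apply: leq_trans (mu_la i).
by apply: cols => //; apply: leq_trans (mu_la i').
Qed.

Lemma eq_hook k la (f g : nat -> nat -> nat) :
    (forall i j, j < rowlen la i -> f i j = g i j) ->
  hook_rows k la f /\ hook_cols k la f -> hook_rows k la g /\ hook_cols k la g.
Proof.
move=> fg [rows cols]; split=> [i j j' lt_j lt_j'|i i' j lt_i lt_j].
  by rewrite -!fg ?(ltn_trans lt_j lt_j') //; apply: rows.
rewrite -!fg ?(leq_trans lt_j (rowlen_anti la (ltnW lt_i))) //; exact: cols.
Qed.

(** * The branching rule for hook tableaux *)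

Section Branching.

Variables (R : comNzRingType) (k : nat) (u : nat -> R).
Local Open Scope ring_scope.

(** The bound m on the letters varies while the type ['I_n] of entries stays fixed, so that
    induction on m takes place in one type of fillings. *)
Definition bounded_filling (n m : nat) la (T : filling n la) : bool :=
  hook_filling k T && [forall c, T c < m]%N.

Definition tableau_sum (n m : nat) la : R :=
  \sum_(T : filling n la | bounded_filling m T) \prod_c u (T c).

Lemma bounded_fillingP n m la (T : filling n la) :
  reflect [/\ hook_rows k la (entry T), hook_cols k la (entry T)
            & forall i j, (j < rowlen la i -> entry T i j < m)%N]
          (bounded_filling m T).
Proof.
apply: (iffP andP) => [[/hook_fillingP[rows cols] /forallP lt_m]|[rows cols lt_m]].
  split=> // i j /cell_exists[c <- <-]; by rewrite entry_cell.
split; first exact/hook_fillingP.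
by apply/forallP => c; rewrite -entry_cell lt_m // ltn_cell_col.
Qed.

Lemma tableau_sum0 n la : tableau_sum n 0 la = (la == empty_part)%:R.
Proof.
rewrite /tableau_sum; case: eqP => [->|/eqP ne0].
  have noc (c : cell empty_part) : False by case: c => -[].
  pose T0 : filling n empty_part := [ffun c => False_rect _ (noc c)].
  rewrite (big_pred1 T0) => [|T]; first by rewrite big1 // => c; case: (noc c).
  have -> : T = T0 by apply/ffunP => c; case: (noc c).
  rewrite /= eqxx; apply/andP; split.
    by apply/forallP => c; case: (noc c).
  by apply/forallP => c; case: (noc c).
have /cell_exists[c _ _] : (0 < rowlen la 0)%N.
  by move: ne0; rewrite -sumn_eq0 sumn_behead rowlen_gt0; case: (la) => -[].
by rewrite big1 // => T /andP[_ /forallP/(_ c)].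
Qed.

Lemma prod_cell la M (F : nat -> nat -> R) : (size la <= M)%N ->
  \prod_(c : cell la) F (cell_row c) (cell_col c) =
  \prod_(i < M) \prod_(j < rowlen la i) F i j.
Proof.
move=> le_M.
transitivity (\prod_(i < size la) \prod_(j < rowlen la i) F i j).
  by rewrite sig_big_dep.
rewrite (big_ord_widen _ (fun i => \prod_(j < rowlen la i) F i j) le_M).
rewrite big_mkcond; apply: eq_bigr => i _ /=; case: ltnP => // le_i.
by rewrite big1 // => -[j lt_j]; move: (lt_j); rewrite rowlen_default.
Qed.

Lemma prod_cell_split mu la (F : nat -> nat -> R) x :
    (forall i, rowlen mu i <= rowlen la i)%N ->
  \prod_(c : cell la)
     (if cell_col c < rowlen mu (cell_row c) then F (cell_row c) (cell_col c)
      else x)%N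
  = x ^+ (sumn la - sumn mu) * \prod_(c : cell mu) F (cell_row c) (cell_col c).
Proof.
move=> mu_la; have [le1 le2] : (size la <= size la + size mu)%N
    /\ (size mu <= size la + size mu)%N by lia.
rewrite (prod_cell (fun i j => if j < rowlen mu i then F i j else x)%N le1).
rewrite (prod_cell F le2) (sumn_rowlen le1) (sumn_rowlen le2) -sumnB //.
rewrite -prodrXr -big_split; apply: eq_bigr => i _ /=.
rewrite -(big_mkord xpredT (fun j => if j < rowlen mu i then F i j else x)%N).
rewrite (big_cat_nat (leq0n _) (mu_la i)) /= mulrC big_mkord; congr (_ * _).
  rewrite big_nat (eq_bigr (fun=> x)) => [|j /andP[le_j _]].
    by rewrite -big_nat prodr_const_nat.
  by rewrite ltnNge le_j.
by apply: eq_bigr => j _; rewrite ltn_ord.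
Qed.

(** Tableaux are grouped by the shape mu of their entries below m; the remaining cells hold m and
    contribute the power of [u m]. *)
Lemma tableau_sumS n m la : (m <= n)%N ->
  tableau_sum n.+1 m.+1 la =
    \sum_(mu <- parts_upto (sumn la) | letter_strip k m mu la)
       u m ^+ (sumn la - sumn mu) * tableau_sum n.+1 m mu.
Proof.
move=> le_mn.
pose fits mu (T : filling n.+1 la) :=
  [forall c, (T c < m)%N == (cell_col c < rowlen mu (cell_row c))%N].
have fitsP mu T : reflect (forall i j, (j < rowlen la i)%N ->
    (entry T i j < m)%N = (j < rowlen mu i)%N) (fits mu T).
  apply: (iffP forallP) => [h i j /cell_exists[c <- <-]|h c].
    by rewrite entry_cell (eqP (h c)).
  by rewrite -entry_cell h ?ltn_cell_col.
(* Each tableau fits exactly one mu, its sublevel shape, so the inner sum has a single term. *)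
transitivity (\sum_(T : filling n.+1 la | bounded_filling m.+1 T)
    \sum_(mu <- parts_upto (sumn la) | letter_strip k m mu la && fits mu T)
       \prod_c u (T c)).
  apply: eq_bigr => T /bounded_fillingP[rows cols lt_m]; symmetry.
  pose nu := sublevel m la (entry T).
  have nu_strip : letter_strip k m nu la by apply: sublevel_strip.
  have nuE := ltn_sublevel m rows cols.
  apply: (big_parts_unique (mu := nu)).
  - exact: letter_strip_sumn nu_strip.
  - by rewrite nu_strip; apply/fitsP => i j lt_j; rewrite nuE lt_j.
  move=> mu /andP[/letter_strip_le mu_la /fitsP fits_mu]; apply: rowlen_inj => i.
  apply/eqP; rewrite eqn_leq; apply/andP; split; apply: leq_ltn_ext => j.
    move=> lt_j; have lt_j' := leq_trans lt_j (mu_la i).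
    by rewrite nuE lt_j' fits_mu.
  by rewrite nuE => /andP[lt_j]; rewrite fits_mu.
rewrite (exchange_big_dep (fun mu => letter_strip k m mu la)) /=;
  last by move=> T mu _ /andP[].
apply: eq_bigr => mu strip; rewrite strip /= mulr_sumr.
have mu_la := letter_strip_le strip.
(* For fixed mu, filling the strip with m and forgetting the strip are inverse bijections. *)
pose extend (T : filling n.+1 mu) : filling n.+1 la :=
  mkfilling n la (fun i j => if (j < rowlen mu i)%N then entry T i j else m).
pose restrict (T : filling n.+1 la) : filling n.+1 mu := mkfilling n mu (entry T).
have entry_le la' (T : filling n.+1 la') i j : (entry T i j <= n)%N.
  by rewrite /entry; case: pickP => // c _; rewrite -ltnS.
have extendE T i j : (j < rowlen la i)%N -> entry (extend T) i j =
    if (j < rowlen mu i)%N then entry T i j else m.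
  by move=> lt_j; rewrite entry_mkfilling //; case: ifP.
have restrictE T i j : (j < rowlen mu i)%N -> entry (restrict T) i j = entry T i j.
  by move=> lt_j; rewrite entry_mkfilling.
have filling_inj la' (T T' : filling n.+1 la') :
    (forall i j, (j < rowlen la' i)%N -> entry T i j = entry T' i j) -> T = T'.
  move=> eq_T; apply/ffunP => c; apply: ord_inj.
  by rewrite -!entry_cell eq_T ?ltn_cell_col.
rewrite (reindex_onto extend restrict) /=; last first.
  move=> T /andP[/bounded_fillingP[_ _ lt_m] /fitsP fits_mu].
  apply: filling_inj => i j lt_j; rewrite extendE //; case: ifP => lt_mu.
    by rewrite restrictE.
  by have := fits_mu i j lt_j; have := lt_m i j lt_j; rewrite lt_mu; lia.
have extend_mu T i j : (j < rowlen mu i)%N -> entry (extend T) i j = entry T i j.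
  by move=> lt_j; rewrite extendE ?lt_j // (leq_trans lt_j).
apply: eq_big => [T|T _]; last first.
  rewrite (eq_bigr (fun c => if (cell_col c < rowlen mu (cell_row c))%N
             then u (entry T (cell_row c) (cell_col c)) else u m)); last first.
    move=> c _; rewrite -(entry_cell (extend T)) extendE ?ltn_cell_col //.
    by case: ifP.
  rewrite (prod_cell_split (fun i j => u (entry T i j))) //; congr (_ * _).
  by apply: eq_bigr => c _; rewrite entry_cell.
have -> : restrict (extend T) = T.
  by apply: filling_inj => i j lt_j; rewrite restrictE // extend_mu.
rewrite eqxx andbT; apply/andP/bounded_fillingP.
  move=> [/bounded_fillingP[rows cols lt_m] /fitsP fits_mu].
  have [rows' cols'] := eq_hook (@extend_mu T) (hook_restrict mu_la rows cols).
  split=> // i j lt_j.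
  by rewrite -extend_mu // fits_mu // (leq_trans lt_j).
move=> [rows cols lt_m].
have [|rows' cols'] := @eq_hook k mu (entry T) (entry (extend T)) _ (conj rows cols).
  by move=> i j lt_j; rewrite extend_mu.
have lt_ext i j : (j < rowlen la i)%N ->
    (entry (extend T) i j < m)%N = (j < rowlen mu i)%N.
  move=> lt_j; rewrite extendE //; case: ifP => [/lt_m -> //|_].
  by rewrite ltnn.
have le_ext i j : (j < rowlen la i)%N -> (entry (extend T) i j <= m)%N.
  by move=> lt_j; rewrite extendE //; case: ifP => [/lt_m/ltnW|].
have [rows2 cols2] := hook_extend strip rows' cols' lt_ext le_ext.
by split; [apply/bounded_fillingP|apply/fitsP].
Qed.

(** The reversal puts the largest letter at the head, where [word_fun] removes it first. *)
Definition hook_word (m : nat) : seq (bool * R) :=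
  rev [seq ((k <= i)%N, u i) | i <- iota 0 m].

Lemma hook_wordS m : hook_word m.+1 = ((k <= m)%N, u m) :: hook_word m.
Proof. by rewrite /hook_word -addn1 iotaD map_cat rev_cat. Qed.

Lemma tableau_sum_word n m la : (m <= n)%N ->
  tableau_sum n m la = word_fun (hook_word m) la.
Proof.
elim: m la => [|m IHm] la le_mn; first exact: tableau_sum0.
case: n le_mn IHm => // n le_mn IHm.
rewrite tableau_sumS // hook_wordS /= /letter_op /letter_strip /=.
by case: (k <= m)%N; apply: eq_bigr => mu _; rewrite IHm // ltnW.
Qed.

Lemma hook_filling_sum n la :
  \sum_(T : filling n la | hook_filling k T) \prod_c u (T c)
    = word_fun (hook_word n) la.
Proof.
rewrite -(@tableau_sum_word n n) //; apply: eq_bigl => T; rewrite /bounded_filling.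
by rewrite andb_idr // => _; apply/forallP => c; apply: ltn_ord.
Qed.

End Branching.

(** * Homogeneous components *)

Section DegreeParts.
Local Open Scope ring_scope.

Lemma weight_homog n la (T : filling n la) : weight T \is (sumn la).-homog.
Proof.
rewrite /weight -(big_morph _ (mpolyXD _) (mpolyX0 _ _)) dhomogX /= mdeg_sum.
have -> : (\sum_(c : cell la) mdeg U_(T c) = \sum_(c : cell la) 1)%N.
  by apply: eq_bigr => c _; rewrite mdeg1.
rewrite sum1_card card_tagged sumnE big_map big_enum /=.
rewrite (sumn_rowlen (leqnn _)); apply/eqP/eq_bigr => i _; exact: card_ord.
Qed.

Lemma schur_homog n la : schur n la \is (sumn la).-homog.
Proof. by apply: rpred_sum => T _; apply: weight_homog. Qed.

Lemma hook_schur_homog k l la : hook_schur k l la \is (sumn la).-homog.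
Proof. by apply: rpred_sum => T _; apply: weight_homog. Qed.

(** As [F la] is homogeneous of degree |la|, projecting onto degree n keeps exactly the terms of
    size n. Applied to both sides of double symmetry, this gives (1). *)
Lemma degree_part_sum n (m : symfun) N (F : intpart -> {mpoly rat[N]}) :
    (forall la, F la \is (sumn la).-homog) ->
  \sum_(la <- finsupp (degree_part n m)) degree_part n m la *: F la =
  pihomog mdeg n (\sum_(la <- finsupp m) m la *: F la).
Proof.
move=> F_homog; have sub : (finsupp (degree_part n m) `<=` finsupp m)%fset.
  exact: finsupp_sub.
rewrite (big_fset_incl _ sub); last by move=> la _ /fsfun_dflt->; rewrite scale0r.
rewrite linear_sum !big_seq; apply: eq_bigr => la m_la.
rewrite fsfunE m_la linearZ /=; case: eqP => [<-|/eqP ne].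
  by rewrite pihomog_dE.
by rewrite (pihomog_ne0 ne (F_homog la)) scale0r scaler0.
Qed.

Lemma doubly_symmetric_degree_part (m : symfun) n :
  doubly_symmetric m -> doubly_symmetric (degree_part n m).
Proof.
move=> m_ds k l; rewrite /schur_sum /hook_schur_sum !degree_part_sum.
- by rewrite -/(schur_sum m (k + l)) m_ds.
- by move=> la; apply: hook_schur_homog.
- by move=> la; apply: schur_homog.
Qed.

End DegreeParts.

(** * Schur and hook Schur polynomials as words, and the conclusions *)

Section SchurWords.
Local Open Scope ring_scope.

Definition var (n i : nat) : {mpoly rat[n]} :=
  if insub i is Some j then 'X_j else 0.

Lemma var_ord n (i : 'I_n) : var n i = 'X_i.
Proof. by rewrite /var valK. Qed.

Lemma hook_schur_word k l la :
  hook_schur k l la = word_fun (hook_word k (var (k + l)) (k + l)) la.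
Proof.
rewrite -hook_filling_sum; apply: eq_bigr => T _.
by apply: eq_bigr => c _; rewrite var_ord.
Qed.

(** With k = n all letters are unprimed, and strict growth in columns is weak growth together with
    distinctness. *)
Lemma is_ssyt_hook n la (T : filling n la) : is_ssyt T = hook_filling n T.
Proof.
apply: eq_forallb => c; apply: eq_forallb => d.
have -> : (n <= T c)%N = false by rewrite leqNgt ltn_ord.
by rewrite /= andbT; congr (_ && (_ ==> _)); rewrite ltn_neqAle andbC.
Qed.

Lemma schur_word n la : schur n la = word_fun (hook_word n (var n) n) la.
Proof.
rewrite -hook_filling_sum; apply: eq_big => [T|T _]; first exact: is_ssyt_hook.
by apply: eq_bigr => c _; rewrite var_ord.
Qed.

Lemma schur_sum_word (m : symfun) n :
  schur_sum m n = symfun_comb (hook_word n (var n) n) m.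
Proof. by apply: eq_bigr => la _; rewrite schur_word. Qed.

Lemma hook_schur_sum_word (m : symfun) k l :
  hook_schur_sum m k l = symfun_comb (hook_word k (var (k + l)) (k + l)) m.
Proof. by apply: eq_bigr => la _; rewrite hook_schur_word. Qed.

Lemma product_exists (f g : symfun) : exists p : symfun,
  forall (R : comAlgType rat) (w : seq (bool * R)),
    symfun_comb w p = symfun_comb w f * symfun_comb w g.
Proof.
pose s (m : symfun) := [seq (m la, la) | la <- finsupp m].
have sE m (R : comAlgType rat) (w : seq (bool * R)) :
    comb w (s m) = symfun_comb w m by rewrite /comb big_map.
have [t tE] := comb_mul (s f) (s g).
have [p pE] := symfun_of_comb t.
by exists p => R w; rewrite pE tE !sE.
Qed.

(** One p gives the product in ordinary and in hook words, so the double symmetry of both factors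
    carries over to it. *)
Lemma doubly_symmetric_product (f g : symfun) :
    doubly_symmetric f -> doubly_symmetric g ->
  exists2 p : symfun, is_product f g p & doubly_symmetric p.
Proof.
move=> f_ds g_ds; have [p pE] := product_exists f g; exists p => [n|k l].
  by rewrite !schur_sum_word pE.
rewrite hook_schur_sum_word pE -!hook_schur_sum_word -f_ds -g_ds.
by rewrite !schur_sum_word pE.
Qed.

Lemma hook_word_unprimed n (u : nat -> rat) :
  hook_word n u n = unprimed (rev (mkseq u n)).
Proof.
rewrite /hook_word /unprimed map_rev -map_comp; congr rev.
by apply/eq_in_map => i; rewrite mem_iota /= => lt_i; rewrite leqNgt lt_i.
Qed.

Lemma hook_word_primed n (u : nat -> rat) :
  hook_word 0 u n = flip_word (unprimed (rev (mkseq u n))).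
Proof. by rewrite /hook_word /flip_word /unprimed -map_comp map_rev -map_comp. Qed.

Lemma meval_fillings n la (P : pred (filling n la)) (u : nat -> rat) :
  (\sum_(T | P T) weight T).@[fun i : 'I_n => u i]
    = \sum_(T | P T) \prod_c u (T c).
Proof.
rewrite raddf_sum; apply: eq_bigr => T _; rewrite /weight /= rmorph_prod.
by apply: eq_bigr => c _; rewrite /= mevalXU.
Qed.

Lemma symfun_sum_parts (m : symfun) N (F : intpart -> rat) :
    (forall la, la \in finsupp m -> (sumn la <= N)%N) ->
  \sum_(la <- finsupp m) m la * F la = \sum_(la <- parts_upto N) m la * F la.
Proof.
move=> le_N; rewrite [RHS](bigID (mem (finsupp m))) /= [X in _ + X]big1 ?addr0.
  rewrite -[RHS]big_filter; apply: perm_big; apply: uniq_perm.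
  - exact: fset_uniq.
  - exact: uniq_filter_parts_upto.
  by move=> la; rewrite mem_filter_parts_upto andb_idr // => /le_N.
by move=> la /fsfun_dflt->; rewrite mul0r.
Qed.

Lemma doubly_symmetric_conj (m : symfun) :
  doubly_symmetric m -> forall la, m la = m (conj_part la).
Proof.
move=> m_ds la.
(* N bounds the support of m and also the given la, which may lie outside the support. *)
pose N := (\max_(mu <- finsupp m) sumn mu + sumn la)%N.
have le_N mu : mu \in finsupp m -> (sumn mu <= N)%N.
  by move=> m_mu; apply: leq_trans (leq_addr _ _); apply: leq_bigmax_seq.
apply/eqP; rewrite -subr_eq0; apply/eqP.
apply: (@word_fun_free N (fun mu => m mu - m (conj_part mu))); last exact: leq_addl.
(* The variables are read from [rev w] because [hook_word] reverses them again. *)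
move=> w; pose u i := nth 0 (rev w) i; pose l := size w.
have wE : rev (mkseq u l) = w by rewrite /l -(size_rev w) mkseq_nth revK.
(* Here X is empty: the hook side has only primed letters, and becomes a sum over conjugate
   shapes. *)
have := congr1 (meval (fun i : 'I_(0 + l) => u i)) (m_ds 0%N l).
rewrite /schur_sum /hook_schur_sum !raddf_sum /=.
under eq_bigr => mu _.
  rewrite mevalZ meval_fillings (eq_bigl _ _ (@is_ssyt_hook _ _)).
  rewrite hook_filling_sum hook_word_unprimed wE.
over.
under [X in _ = X -> _]eq_bigr => mu _.
  rewrite mevalZ meval_fillings (@hook_filling_sum _ 0 u l mu).
  rewrite hook_word_primed wE word_fun_conj.
over.
rewrite (symfun_sum_parts _ le_N).
rewrite (@symfun_sum_parts _ _ (fun mu => word_fun (unprimed w) (conj_part mu)) le_N).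
move=> eq_sum; under eq_bigr do rewrite mulrBl.
rewrite sumrB eq_sum; apply/eqP; rewrite subr_eq0; apply/eqP.
rewrite [RHS](@big_parts_reindex _ N _ xpredT _ conj_part conj_part).
- by apply: eq_bigr => mu _; rewrite conj_partK.
- by move=> mu; rewrite sumn_conj conj_partK.
- by move=> mu; rewrite sumn_conj conj_partK.
Qed.

End SchurWords.

Theorem lemma2p2 :
  [/\ (forall (m : symfun) (n : nat),
         doubly_symmetric m -> doubly_symmetric (degree_part n m)),
      (forall m : symfun,
         doubly_symmetric m -> forall la : intpart, m la = m (conj_part la))
    & (forall f g : symfun,
         doubly_symmetric f -> doubly_symmetric g ->
         exists2 p : symfun, is_product f g p & doubly_symmetric p)].
Proof.
split.
- exact: doubly_symmetric_degree_part.
- exact: doubly_symmetric_conj.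
- exact: doubly_symmetric_product.
Qed.
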